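(* Let $S$ be a band semigroup. Then for every integer $n\ge 0$: $\mathcal{HC}^{2n+1}(\ell^1(S))=0$, and $\mathcal{HC}^{2n}(\ell^1(S))=\{[\tau^{(2n)}] : \tau\in \mathcal{Z}^0(\ell^1(S),\ell^1(S)')\}$; that is, the cyclic cohomology of $\ell^1(S)$ vanishes in all odd degrees, and in even degree $2n$ it consists exactly of the classes of the cyclic cocycles $\tau^{(2n)}$ with $\tau$ a continuous trace on $\ell^1(S)$.
   Context: A band semigroup is a semigroup all of whose elements are idempotent; $\ell^1(S)$ is its convolution Banach algebra. For a Banach algebra $A$ and $n\ge 0$, let $\mathcal{C}_n(A)=A^{\widehat{\otimes}(n+1)}$ (projective tensor product). $\mathcal{C}^n(A,A')$ is the space of bounded $n$-linear maps $T:A^n\to A'$, identified with bounded linear functionals on $\mathcal{C}_n(A)$ via $T(a_1\otimes\cdots\otimes a_{n+1})=T(a_1,\dots,a_n)(a_{n+1})$; it is $0$ for $n<0$. The coboundary $\delta:\mathcal{C}^n(A,A')\to\mathcal{C}^{n+1}(A,A')$ is the adjoint of $d:\mathcal{C}_{n+1}(A)\to\mathcal{C}_n(A)$, $d(a_1\otimes\cdots\otimes a_{n+2})=a_2\otimes\cdots\otimes a_{n+1}\otimes a_{n+2}a_1+\sum_{j=1}^{n+1}(-1)^j a_1\otimes\cdots\otimes a_ja_{j+1}\otimes\cdots\otimes a_{n+2}$. Let $\mathbf{t}(a_1\otimes\cdots\otimes a_{n+1})=(-1)^n a_{n+1}\otimes a_1\otimes\cdots\otimes a_n$ on $\mathcal{C}_n(A)$;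 a cochain $T$ is cyclic if $T\circ\mathbf{t}=T$. $\mathcal{CC}^n(A)$ is the space of cyclic $n$-cochains (a subcomplex under $\delta$), $\mathcal{ZC}^n(A)=\ker\delta\cap\mathcal{CC}^n(A)$, $\mathcal{BC}^n(A)=\delta(\mathcal{CC}^{n-1}(A))$, and $\mathcal{HC}^n(A)=\mathcal{ZC}^n(A)/\mathcal{BC}^n(A)$. $\mathcal{Z}^0(A,A')$ is the space of continuous traces on $A$ (functionals $\tau\in A'$ with $\tau(ab)=\tau(ba)$). For $\psi\in A'$, $\psi^{(n)}\in\mathcal{C}^n(A,A')$ is $\psi^{(n)}(a_1,\dots,a_n)(a_{n+1})=\psi(a_1\cdots a_{n+1})$. If $\tau$ is a continuous trace, $\tau^{(2n)}$ is a cyclic cocycle; $[\,\cdot\,]$ denotes the cyclic cohomology class. *)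

(* Defs.v *)
From HB Require Import structures.
From mathcomp Require Import all_boot all_order all_algebra.
From mathcomp Require Import all_classical all_reals all_analysis.
From mathcomp Require Import complex.

Set Implicit Arguments.
Unset Strict Implicit.
Unset Printing Implicit Defensive.

Import Order.TTheory GRing.Theory Num.Theory.
Import numFieldNormedType.Exports.
Import ComplexField.Normc.

Local Open Scope classical_set_scope.
Local Open Scope ring_scope.
Local Open Scope complex_scope.

(* The carrier of a semigroupType is a choiceType, which classically every type
   is: S may be empty or uncountable. *)
Definition band (S : semigroupType) : Prop := forall x : S, (x * x = x)%g.

Section ell1.
Variables (R : realType) (I : choiceType).
Implicit Types f g : I -> R[i]^o.

(* Sum of the moduli, possibly +oo; normc is the modulus with values in R. *)
Definition ell1_esum f : \bar R := \esum_(i in [set: I]) (normc (f i))%:E.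

Definition ell1_pred : {pred I -> R[i]^o} :=
  fun f => (ell1_esum f < +oo)%E.

Lemma normc_ge0 (z : R[i]) : 0 <= normc z.
Proof. by case: z => a b; rewrite /normc sqrtr_ge0. Qed.

Lemma normc_norm (z : R[i]) : `|z| = (normc z)%:C.
Proof. by rewrite normc_def; case: z. Qed.

Lemma ell1_esum_ge0 f : (0 <= ell1_esum f)%E.
Proof. by apply: esum_ge0 => i _; rewrite lee_fin normc_ge0. Qed.

Lemma ell1_esumD f g : (ell1_esum (f + g)%R <= ell1_esum f + ell1_esum g)%E.
Proof.
rewrite /ell1_esum -esumD.
- by apply: le_esum => i _; rewrite -EFinD lee_fin; exact: le_normcD.
- by move=> i _; rewrite lee_fin normc_ge0.
- by move=> i _; rewrite lee_fin normc_ge0.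
Qed.

Lemma esumZ (T : choiceType) (D : set T) (c : R) (a : T -> \bar R) :
  0 <= c -> (forall t, 0 <= a t)%E ->
  (\esum_(i in D) (c%:E * a i) = c%:E * \esum_(i in D) a i)%E.
Proof.
move=> c0 a0; rewrite /esum -ereal_supZl//; last first.
  by apply/set0P; exists 0%E, set0; [exact: fsets_set0|rewrite fsbig_set0].
rewrite image_comp; congr (ereal_sup _); apply: eq_imagel => A [finA AD] /=.
by rewrite ge0_mule_fsumr.
Qed.

Lemma ell1_esumZ c f : ell1_esum (c *: f) = ((normc c)%:E * ell1_esum f)%E.
Proof.
rewrite -esumZ ?normc_ge0//; last by move=> i; rewrite lee_fin normc_ge0.
by apply: eq_esum => i _; rewrite -EFinM -normcM.
Qed.

Lemma ell1_submod : submod_closed ell1_pred.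
Proof.
split=> [|c f g]; rewrite !unfold_in.
  by rewrite /ell1_esum esum1// => i _; rewrite normc0.
move=> Hf Hg; apply: le_lt_trans (ell1_esumD _ _) _.
by rewrite lte_add_pinfty// ell1_esumZ lte_mul_pinfty// ?lee_fin ?normc_ge0.
Qed.

HB.instance Definition _ :=
  GRing.isSubmodClosed.Build _ _ ell1_pred ell1_submod.

Record ell1 := Ell1 { ell1_val :> I -> R[i]^o; ell1_valP : ell1_val \in ell1_pred }.

HB.instance Definition _ := [isSub for ell1_val].
HB.instance Definition _ := [Choice of ell1 by <:].
HB.instance Definition _ := [SubChoice_isSubLmodule of ell1 by <:].

Definition ell1_norm (f : ell1) : R[i] := (fine (ell1_esum f))%:C.

Lemma ell1_esumK (f : ell1) : (fine (ell1_esum f))%:E = ell1_esum f.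
Proof. by rewrite fineK// ge0_fin_numE ?ell1_esum_ge0//; exact: ell1_valP. Qed.

Lemma ell1_normD (f g : ell1) : ell1_norm (f + g) <= ell1_norm f + ell1_norm g.
Proof.
rewrite -rmorphD lecR -lee_fin EFinD !ell1_esumK; exact: ell1_esumD.
Qed.

Lemma ell1_normZ (c : R[i]) (f : ell1) : ell1_norm (c *: f) = `|c| * ell1_norm f.
Proof.
rewrite normc_norm -rmorphM; congr _%:C; apply: EFin_inj.
rewrite EFinM !ell1_esumK; exact: ell1_esumZ.
Qed.

Lemma ell1_norm0_eq0 (f : ell1) : ell1_norm f = 0 -> f = 0.
Proof.
move=> /complexI f0; apply/val_inj/funext => i /=; apply: eq0_normc.
apply/eqP; rewrite eq_le normc_ge0 andbT -lee_fin -f0 ell1_esumK.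
apply: esum_ge; exists [set i]; first by split.
by rewrite fsbig_set1.
Qed.

HB.instance Definition _ := Lmodule_isNormed.Build R[i] ell1
  ell1_normD ell1_normZ ell1_norm0_eq0.

End ell1.

Section convolution.
Variable R : realType.

(* Sum of an absolutely summable family, as the difference of the sums of the
   positive and the negative part, taken separately on Re and Im. *)
Definition rsum (T : choiceType) (D : set T) (a : T -> R) : R :=
  fine (\esum_(t in D) (Num.max (a t) 0)%:E)
  - fine (\esum_(t in D) (Num.max (- a t) 0)%:E).

Definition csum (T : choiceType) (D : set T) (a : T -> R[i]) : R[i] :=
  rsum D (fun t => complex.Re (a t)) +i* rsum D (fun t => complex.Im (a t)).

Lemma rsum_le (T : choiceType) (D : set T) (a : T -> R) :
  (`|rsum D a|%:E <= \esum_(t in D) `|a t|%:E)%E.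
Proof.
have p0 (b : T -> R) : (0 <= \esum_(t in D) (Num.max (b t) 0)%:E)%E.
  by apply: esum_ge0 => t _; rewrite lee_fin le_max lexx orbT.
have -> : (\esum_(t in D) `|a t|%:E = \esum_(t in D) (Num.max (a t) 0)%:E
    + \esum_(t in D) (Num.max (- a t) 0)%:E)%E.
  rewrite -esumD; try by move=> t _; rewrite lee_fin le_max lexx orbT.
  apply: eq_esum => t _; rewrite -EFinD; congr EFin.
  have [at0|at0] := lerP 0 (a t).
    by rewrite max_r ?addr0 ?ger0_norm// oppr_le0.
  by rewrite max_l ?add0r ?ltr0_norm// oppr_ge0 ltW.
rewrite /rsum; have := p0 a; have := p0 (fun t => - a t) => /=.
case: (esum _ _) => [x||]//; case: (esum _ _) => [y||]//=; rewrite ?addey ?addye ?leey//.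
by rewrite !lee_fin => x0 y0; rewrite (le_trans (ler_normB _ _))// !ger0_norm.
Qed.

Lemma csum_le (T : choiceType) (D : set T) (a : T -> R[i]) :
  ((normc (csum D a))%:E <= 2%:E * \esum_(t in D) (normc (a t))%:E)%E.
Proof.
have nRI (z : R[i]) : `|complex.Re z| <= normc z /\ `|complex.Im z| <= normc z.
  by case: z => x y; split; rewrite /normc/= -sqrtr_sqr ler_sqrt
    ?lerDl ?lerDr ?addr_ge0 ?sqr_ge0.
have nD (x y : R) : normc (x +i* y) <= `|x| + `|y|.
  have -> : x +i* y = x%:C + (0 +i* y) by simpc.
  rewrite (le_trans (le_normcD _ _))//.
  by rewrite /normc/= expr0n/= addr0 add0r !sqrtr_sqr.
rewrite (@le_trans _ _ (\esum_(t in D) `|complex.Re (a t)|%:E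
    + \esum_(t in D) `|complex.Im (a t)|%:E)%E)//.
  apply: (@le_trans _ _ (`|rsum D (fun t => complex.Re (a t))|
      + `|rsum D (fun t => complex.Im (a t))|)%:E); first by rewrite lee_fin nD.
  by rewrite EFinD leeD// rsum_le.
rewrite mule_natl mule2n leeD//; apply: le_esum => t _;
  by rewrite lee_fin; have [] := nRI (a t).
Qed.

Variable S : semigroupType.
Implicit Types f g : ell1 R S.

(* (f * g)(s) is the sum of f(x) g(y) over all x, y with x y = s. *)
Definition ell1_mul_fun f g : S -> R[i]^o := fun s =>
  csum [set p : S * S | (p.1 * p.2 = s)%g] (fun p => f p.1 * g p.2).

Lemma ell1_mul_subproof f g : ell1_mul_fun f g \in @ell1_pred R S.
Proof.
have nn h (x : S) : (0 <= (normc (h x : R[i]))%:E)%E by rewrite lee_fin normc_ge0.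
pose F (p : S * S) : \bar R := ((normc (f p.1))%:E * (normc (g p.2))%:E)%E.
have F0 p : (0 <= F p)%E by rewrite mule_ge0 ?nn.
pose D (s : S) : set (S * S) := [set p | (p.1 * p.2 = s)%g].
have sumF : \esum_(p in [set: S * S]) F p = (ell1_esum f * ell1_esum g)%E.
  transitivity (\esum_(x in [set: S]) \esum_(y in [set: S]) F (x, y)).
    rewrite esum_esum// (_ : _ `*`` _ = setT); last by apply/seteqP; split.
    by apply: eq_esum => -[].
  transitivity (\esum_(x in [set: S]) (ell1_esum g * (normc (f x))%:E)%E).
    by apply: eq_esum => x _; rewrite /F/= esumZ ?normc_ge0// muleC.
  rewrite -(ell1_esumK g) esumZ ?fine_ge0 ?ell1_esum_ge0//.
  by rewrite muleC.
have sumD : \esum_(s in [set: S]) \esum_(p in D s) F p =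
    \esum_(p in [set: S * S]) F p.
  rewrite esum_esum//.
  rewrite (reindex_esum [set: S * S] _ (fun p => ((p.1 * p.2)%g, p)))//.
  split=> //= [p q _ _ [_ //]|[s p] /= [_ <-]]; first by exists p.
change (ell1_esum (ell1_mul_fun f g) < +oo)%E.
apply: (@le_lt_trans _ _ (2%:E * (ell1_esum f * ell1_esum g))%E); last first.
  by rewrite -(ell1_esumK f) -(ell1_esumK g) -!EFinM ltry.
rewrite -sumF -sumD -esumZ//; last by move=> s; exact: esum_ge0.
apply: le_esum => s _; rewrite (le_trans (csum_le _ _))//.
by apply: lee_wpmul2l => //; apply: le_esum => p _; rewrite /F -EFinM -normcM.
Qed.

Definition ell1_mul f g : ell1 R S := Ell1 (ell1_mul_subproof f g).

End convolution.

(* Completeness of A and the Banach algebra axioms on mul play no role in the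
   definitions below. An n-tuple (a_1, ..., a_n) is a function 'I_n -> A, with
   a_i at index i - 1. *)
Section cyclic_cohomology.
Variables (K : numFieldType) (A : normedModType K) (mul : A -> A -> A).

(* A': bounded linear functionals. *)
Definition dual_space : set (A -> K) :=
  [set f | scalar f /\ exists M : K, forall x, `|f x| <= M * `|x|].

Definition set_coord n (a : 'I_n -> A) (i : 'I_n) (x : A) : 'I_n -> A :=
  fun j => if j == i then x else a j.

(* C^n(A, A'): the bounded n-linear maps A^n -> A'. The last clause says that
   the norm of T a in A' is at most M |a_1| ... |a_n|. *)
Definition cochain n : set (('I_n -> A) -> A -> K) :=
  [set T | [/\ forall a, dual_space (T a),
    forall a i (c : K) x y z, T (set_coord a i (c *: x + y)) z =
      c * T (set_coord a i x) z + T (set_coord a i y) z &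
    exists M : K, forall a x, `|T a x| <= M * \prod_(i < n) `|a i| * `|x|]].

(* The value of T, as a functional on C_n(A), at the elementary tensor
   b_1 (x) ... (x) b_(n+1). *)
Definition pairing n (T : ('I_n -> A) -> A -> K) (b : 'I_n.+1 -> A) : K :=
  T (fun i => b (widen_ord (leqnSn n) i)) (b ord_max).

(* b_2 (x) ... (x) b_(n+1) (x) b_(n+2) b_1 *)
Definition face0 n (b : 'I_n.+2 -> A) : 'I_n.+1 -> A := fun i =>
  if i == ord_max then mul (b ord_max) (b ord0) else b (lift ord0 i).

(* b_1 (x) ... (x) b_j b_(j+1) (x) ... (x) b_(n+2), where j is the index
   counted from 1, so that the factor j of the result has index j - 1. *)
Definition face n (j : 'I_n.+1) (b : 'I_n.+2 -> A) : 'I_n.+1 -> A := fun i =>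
  if (i < j)%N then b (widen_ord (leqnSn n.+1) i)
  else if i == j then mul (b (widen_ord (leqnSn n.+1) i)) (b (lift ord0 i))
  else b (lift ord0 i).

Definition rcons_coord n (a : 'I_n -> A) (x : A) : 'I_n.+1 -> A :=
  fun i => if unlift ord_max i is Some j then a j else x.

Definition coboundary n (T : ('I_n -> A) -> A -> K) :
    ('I_n.+1 -> A) -> A -> K := fun a x =>
  let b := rcons_coord a x in
  pairing T (face0 b) + \sum_(j < n.+1) (-1) ^+ j.+1 * pairing T (face j b).

(* T o t = T; ord_pred is the cyclic predecessor, so that the tuple below is
   (b_(n+1), b_1, ..., b_n). *)
Definition cyclic n (T : ('I_n -> A) -> A -> K) : Prop :=
  forall b : 'I_n.+1 -> A,
    (-1) ^+ n * pairing T (fun i => b (ord_pred i)) = pairing T b.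

Definition CC n : set (('I_n -> A) -> A -> K) :=
  [set T | cochain T /\ cyclic T].

Definition ZC n : set (('I_n -> A) -> A -> K) :=
  [set T | CC T /\ coboundary T = 0].

(* CC^(-1) = 0 *)
Definition BC n : set (('I_n -> A) -> A -> K) :=
  match n with
  | 0 => [set 0]
  | m.+1 => (@coboundary m) @` (@CC m)
  end.

(* The class [T] of T is the coset T + BC^n. *)
Definition cyclic_class n (T : ('I_n -> A) -> A -> K) :
    set (('I_n -> A) -> A -> K) := [set T + U | U in @BC n].

(* The quotient ZC^n / BC^n, as its set of cosets; its zero is BC^n. *)
Definition HC n : set (set (('I_n -> A) -> A -> K)) :=
  [set cyclic_class T | T in @ZC n].

(* Z^0(A, A') *)
Definition traces : set (A -> K) :=
  [set psi | dual_space psi /\ forall a b, psi (mul a b) = psi (mul b a)].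

Definition tuple_prod n (b : 'I_n.+1 -> A) : A :=
  foldl mul (b ord0) [seq b (lift ord0 i) | i <- enum 'I_n].

(* psi^(n) *)
Definition power_cochain n (psi : A -> K) : ('I_n -> A) -> A -> K :=
  fun a x => psi (tuple_prod (rcons_coord a x)).

End cyclic_cohomology.

Arguments CC {K A} n _.
Arguments ZC {K A} mul n _.
Arguments BC {K A} mul n _.
Arguments HC {K A} mul n _.
Arguments cyclic_class {K A} mul {n} T _.
Arguments power_cochain {K A} mul n psi _ _.

(* Main.v *)
Require Import Defs.
From HB Require Import structures.
From mathcomp Require Import all_boot all_order all_algebra.
From mathcomp Require Import all_classical all_reals all_analysis.
From mathcomp Require Import complex zify ring lra.
Local Open Scope classical_set_scope.

(* Bounded multilinear forms on l^1(S) are bounded functions on tuples of S, so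
   the claim is about cyclic cochains on words x = (x_0, ..., x_n) in S, with
   bounds depending on n only.

   Write a <= b for a b a = a. The classes of this preorder are rectangular bands
   and form a semilattice with meet [a b]; pick a representative e_a of each class.
   Since a e_a . e_a a = a, splitting the entries whose class is minimal in the
   word, a |-> (a e_a, e_a a), and summing over all positions gives an operator h
   on cyclic cochains. For a cyclic cocycle phi, (d h phi)(x) is
   defect(x) phi(x) plus values of phi at words of strictly larger potential. The
   potential is a natural number bounded in terms of n (words are compared inside
   the finite semilattice generated by the entries of the starting word), and the
   defect is a natural number at most n + 1 that vanishes only at the constant
   words (e, ..., e). Hence boundedly many corrections phi - (1/c) d h phi with
   1 <= c <= n + 1 kill any cocycle that vanishes at the constant words. A cyclic
   cocycle of odd degree always does, by the sign in cyclicity; in even degree one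
   first subtracts tau^(2n), where tau(a) = phi(e_a, ..., e_a), which is a trace
   because a b and b a lie in the same class. *)

Set Implicit Arguments.
Unset Strict Implicit.
Unset Printing Implicit Defensive.

Import Order.TTheory GRing.Theory Num.Theory.
Import numFieldNormedType.Exports.
Import ComplexField.Normc.

#[local] Arguments rot : simpl never.

(** * Bands *)

Section Band.
Local Open Scope group_scope.
Variables (S : semigroupType) (idem : forall x : S, (x * x = x)%g).
Implicit Types a b c u v x y z : S.

(** A primitive has to be bounded over all words at once, while the semilattice of [S] may be
    infinite, so an induction along it is of no use: the number of corrections may depend on the
    degree only. The operator h is one formula for all words; generators enter only in the proof
    that its error terms vanish. Only minimal entries are split because splitting is compatible with
    merging only at the lower letter. If a <= b and e = e_a, then e also represents the class of a
    b, and a b e = a e; so merging and then splitting yields (a e, e a b), the word obtained by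
    splitting a and then merging with b. For incomparable a and b this fails, but the words that
    remain reach deeper or have more minimal entries. The three counts in the potential answer to
    three kinds of error: a letter lower than anything reached so far, additional minimal entries,
    and, inside one class, where (a, b) turns into (a e, e b), an additional pair that this move
    leaves unchanged. *)

Definition bandle x y := x * y * x == x.
Local Notation "x <<= y" := (bandle x y) (at level 70).
Definition bandeq x y := (x <<= y) && (y <<= x).
Local Notation "x ~~ y" := (bandeq x y) (at level 70).

(* With [x = ua] and [z = axv]: [x = xa] gives [xz = xv], so [xv * z = xz * z = xz]. *)
Lemma band_absorb u a v : u * a * v * a * (u * a * v) = u * a * v.
Proof.
have xa : u * a * a = u * a by rewrite -mulgA idem.
move: (u * a) xa => x xa.
have xz : x * (a * (x * v)) = x * v by rewrite mulgA xa mulgA idem.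
have -> : x * v * a * (x * v) = x * v * (a * (x * v)) by rewrite !mulgA.
by rewrite -[in X in X * _]xz -mulgA idem xz.
Qed.

Lemma bandlexx x : x <<= x.
Proof. by rewrite /bandle !idem. Qed.

(** Conversely [x = x * y * x] has [y] as a factor, so the preorder is divisibility by two-sided
    factors, Green's J-order. *)
Lemma bandle_factor u a v : u * a * v <<= a.
Proof. by rewrite /bandle band_absorb. Qed.

Lemma bandle_trans y x z : x <<= y -> y <<= z -> x <<= z.
Proof.
move=> /eqP xy /eqP yz.
have -> : x = x * y * z * (y * x) by rewrite -{1}xy -{1}yz !mulgA.
exact: bandle_factor.
Qed.

Lemma bandle_mull x y : x * y <<= x.
Proof. by rewrite /bandle mulgA -(mulgA _ x x) idem -mulgA idem. Qed.

Lemma bandle_mulr x y : x * y <<= y.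
Proof. by rewrite /bandle -(mulgA x) idem idem. Qed.

Lemma bandle_mul x y z : z <<= x -> z <<= y -> z <<= x * y.
Proof.
(* [y * z * x] is the link: [z] lies below it, and its square exhibits [x * y] as a factor. *)
move=> /eqP zx /eqP zy; apply: (@bandle_trans (y * z * x)).
  apply/eqP; rewrite !mulgA zy.
  by rewrite -[X in _ = X]zx.
have -> : y * z * x = y * z * (x * y) * (z * x).
  by rewrite -[LHS]idem !mulgA.
exact: bandle_factor.
Qed.

Lemma bandle_mulE x y z : (z <<= x * y) = (z <<= x) && (z <<= y).
Proof.
apply/idP/andP => [h|[]]; last exact: bandle_mul.
by split; apply: bandle_trans h _; rewrite ?bandle_mull ?bandle_mulr.
Qed.

Lemma bandeqxx x : x ~~ x.
Proof. by rewrite /bandeq bandlexx. Qed.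

Lemma bandeq_sym x y : (x ~~ y) = (y ~~ x).
Proof. exact: andbC. Qed.

Lemma bandeq_trans y x z : x ~~ y -> y ~~ z -> x ~~ z.
Proof.
move=> /andP[xy yx] /andP[yz zy]; apply/andP; split.
  exact: bandle_trans xy yz.
exact: bandle_trans zy yx.
Qed.

Lemma bandeq_lel x y z : x ~~ y -> (x <<= z) = (y <<= z).
Proof.
by move=> /andP[xy yx]; apply/idP/idP; apply: bandle_trans.
Qed.

Lemma bandeq_ler x y z : x ~~ y -> (z <<= x) = (z <<= y).
Proof.
by move=> /andP[xy yx]; apply/idP/idP => h; apply: bandle_trans h _.
Qed.

Lemma bandeq_mulC x y : x * y ~~ y * x.
Proof. by rewrite /bandeq !bandle_mulE !bandle_mull !bandle_mulr. Qed.

Lemma bandeq_mull x y : x <<= y -> x * y ~~ x.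
Proof. by move=> h; rewrite /bandeq bandle_mull bandle_mulE bandlexx h. Qed.

Lemma bandeq_mulr x y : y <<= x -> x * y ~~ y.
Proof. by move=> h; rewrite /bandeq bandle_mulr bandle_mulE bandlexx h. Qed.

(** Inside one class, a rectangular band, middle factors drop out. The letter [b] may lie outside
    the class, but by idempotence [a * (b * c)], which lies in it, can take its place between [a]
    and [c]. *)
Lemma band_rect a b c : a <<= b -> a ~~ c -> a * b * c = a * c.
Proof.
have rect d : d ~~ a -> d ~~ c -> a * d * c = a * c.
  move=> da dc.
  have /eqP ada : a <<= d by case/andP: da.
  have /eqP cdc : c <<= d by case/andP: dc.
  have /eqP dacd : d <<= a * c.
    by rewrite bandle_mulE; case/andP: da => ->; case/andP: dc => ->.
  by rewrite -[in RHS]ada -[in RHS]cdc -[in LHS]dacd !mulgA.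
move=> ab ac.
have bc : b * c ~~ a.
  rewrite bandeq_sym; apply: (bandeq_trans ac).
  by rewrite bandeq_sym bandeq_mulr // -(bandeq_lel _ ac).
have <- := rect (a * (b * c)); first by rewrite !mulgA idem -!mulgA idem.
  apply: bandeq_mull; by case/andP: bc.
apply: bandeq_trans ac; apply: bandeq_mull; by case/andP: bc.
Qed.

Lemma band_rectL a b : a ~~ b -> a * b * a = a.
Proof. by case/andP=> /eqP. Qed.

(** [choose] gives the same element for extensionally equal predicates, so the representative
    depends on the class only, see [eq_rep]. *)
Definition rep x := choose (bandeq x) x.

Lemma bandeq_rep x : x ~~ rep x.
Proof. exact: chooseP (bandeqxx x). Qed.

Lemma eq_rep x y : x ~~ y -> rep x = rep y.
Proof.
move=> xy; have e z : (x ~~ z) = (y ~~ z).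
  apply/idP/idP; apply: bandeq_trans => //; by rewrite bandeq_sym.
rewrite /rep (eq_choose e); apply: choose_id; last exact: bandeqxx.
by rewrite -e bandeqxx.
Qed.

Lemma rep_rep x : rep (rep x) = rep x.
Proof. by apply: eq_rep; rewrite bandeq_sym bandeq_rep. Qed.

End Band.

Arguments rep {S}.

Lemma eq_sign_odd (K : pzRingType) i j :
  odd i = odd j -> ((-1) ^+ i = (-1) ^+ j :> K)%R.
Proof. by move=> ij; rewrite -[LHS]signr_odd ij signr_odd. Qed.

Ltac parity := rewrite ?(oddD, oddM, oddB, oddS, negbK) //=;
  repeat match goal with |- context [odd ?n] => case: (odd n) end => //.

(** * Cyclic cochains on words *)

Section CyclicSum.
Local Open Scope ring_scope.
Variables (K : comPzRingType) (T : Type).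
Implicit Types (f g phi : seq T -> K) (x y : seq T).

(** The norm operator of cyclic cohomology: the sum of the powers of the signed rotation, where one
    rotation of a word of length [n + 1] carries [(-1) ^+ n]. *)
Definition cycsum f x : K :=
  \sum_(k < size x) (-1) ^+ ((size x).-1 * k) * f (rot k x).

(** [m] counts all arguments, so the degree of the cochain is [m.-1]. *)
Definition cycfun m phi := forall x, size x = m ->
  phi (rot 1 x) = (-1) ^+ m.-1 * phi x.

Lemma eq_cycsum f g x :
  (forall y, size y = size x -> f y = g y) -> cycsum f x = cycsum g x.
Proof. by move=> fg; apply: eq_bigr => k _; rewrite fg // size_rot. Qed.

(** The summand that wraps around has sign exponent [m * m], of the parity of [m]: a full turn of a
    word of length [m + 1] costs no sign. *)
Lemma cycsum_rot1 f x :
  cycsum f (rot 1 x) = (-1) ^+ (size x).-1 * cycsum f x.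
Proof.
rewrite /cycsum size_rot; case sx: (size x) => [|m].
  by rewrite !big_ord0 mulr0.
rewrite big_ord_recr mulr_sumr big_ord_recl /= addrC; congr (_ + _).
  have -> : rot m (rot 1 x) = rot 0 x.
    by rewrite -rotD ?sx ?addn1 // -sx rot_size rot0.
  by rewrite mulrA -exprD; congr (_ * _); apply: eq_sign_odd; parity.
apply: eq_bigr => i _; rewrite /bump leq0n add1n -rotD ?sx ?addn1 ?ltnS ?(ltnW (ltn_ord i)) //.
rewrite mulrA -exprD; congr (_ * _); apply: eq_sign_odd; parity.
Qed.

Lemma cycsum_rot f x j : (j <= size x)%N ->
  cycsum f (rot j x) = (-1) ^+ ((size x).-1 * j) * cycsum f x.
Proof.
elim: j => [|j IH] jx; first by rewrite muln0 mul1r rot0.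
rewrite -add1n rotD // cycsum_rot1 size_rot IH ?(ltnW jx) // mulrA -exprD.
by rewrite mulnDr muln1.
Qed.

Lemma cycfun_cycsum f m : cycfun m (cycsum f).
Proof. by move=> x <-; rewrite cycsum_rot1. Qed.

Lemma cycfun_rot m phi x j : cycfun m phi -> size x = m -> (j <= m)%N ->
  phi (rot j x) = (-1) ^+ (m.-1 * j) * phi x.
Proof.
move=> cphi sx; elim: j => [|j IH] jm; first by rewrite muln0 mul1r rot0.
rewrite -add1n rotD ?sx // cphi ?size_rot // IH ?(ltnW jm) // mulrA -exprD.
by rewrite mulnDr muln1.
Qed.

(** Under a cyclic sum a term may be replaced by its signed rotation; this brings terms produced at
    different positions to a common one. *)
Lemma cycsum_shift f x j : (j <= size x)%N ->
  cycsum (fun y => (-1) ^+ ((size x).-1 * j) * f (rot j y)) x = cycsum f x.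
Proof.
move=> jx; have := cycsum_rot f jx.
have -> : cycsum f (rot j x) = cycsum (f \o rot j) x.
  by rewrite /cycsum size_rot; apply: eq_bigr => k _ /=; rewrite rot_rot.
move=> /(congr1 ( *%R ((-1) ^+ ((size x).-1 * j)))).
rewrite signrMK => <-.
by rewrite /cycsum mulr_sumr; apply: eq_bigr => k _; rewrite mulrCA.
Qed.

(** The sign of each rotation cancels against the cyclicity of [phi], and an unsigned sum of [g] is
    left; [defect] arises in this way. *)
Lemma cycsum_cycfun m g phi x : cycfun m phi -> size x = m ->
  cycsum (fun y => g y * phi y) x = (\sum_(k < m) g (rot k x)) * phi x.
Proof.
move=> cphi sx; rewrite /cycsum sx mulr_suml; apply: eq_bigr => k _.
by rewrite (cycfun_rot cphi) ?(ltnW (ltn_ord k)) // mulrCA signrMK.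
Qed.

Lemma cycsum0 x : cycsum (fun=> 0) x = 0.
Proof. by rewrite /cycsum big1 // => i _; rewrite mulr0. Qed.

Lemma cycsumD f g x : cycsum (fun y => f y + g y) x = cycsum f x + cycsum g x.
Proof.
by rewrite /cycsum -big_split; apply: eq_bigr => i _; rewrite mulrDr.
Qed.

Lemma cycsumZ c f x : cycsum (fun y => c * f y) x = c * cycsum f x.
Proof.
by rewrite /cycsum mulr_sumr; apply: eq_bigr => i _; rewrite mulrCA.
Qed.

Lemma cycsumN f x : cycsum (fun y => - f y) x = - cycsum f x.
Proof.
by rewrite /cycsum -sumrN; apply: eq_bigr => i _; rewrite mulrN.
Qed.

Lemma cycsum_sum n (F : 'I_n -> seq T -> K) x :
  cycsum (fun y => \sum_(i < n) F i y) x = \sum_(i < n) cycsum (F i) x.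
Proof.
rewrite /cycsum exchange_big; apply: eq_bigr => k _ /=.
by rewrite mulr_sumr.
Qed.

End CyclicSum.

Section Merge.
Local Open Scope ring_scope.
Variables (K : comPzRingType) (T : Type) (op : T -> T -> T).
Implicit Types (x y : seq T) (psi : seq T -> K).

Fixpoint mergeat j x := match j, x with
  | 0, a :: b :: t => op a b :: t
  | j.+1, a :: t => a :: mergeat j t
  | _, _ => x
  end.

Lemma mergeat_cat u a b v :
  mergeat (size u) (u ++ [:: a, b & v]) = u ++ op a b :: v.
Proof. by elim: u => //= c u ->. Qed.

Lemma size_merge0 y : (1 < size y)%N -> size (mergeat 0 y) = (size y).-1.
Proof. by case: y => [|a [|b t]]. Qed.

Lemma split_pair j x : (j.+1 < size x)%N ->
  exists u a b v, x = u ++ [:: a, b & v] /\ size u = j.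
Proof.
elim: j x => [|j IH] [|a x] //; first by case: x => // b x; exists [::], a, b, x.
rewrite ltnS => /IH [u [c [d [v [-> <-]]]]].
by exists (a :: u), c, d, v.
Qed.

(* On cyclic cochains every face is, up to sign, a rotation of the face that
   merges the first two entries; this is the negative of the coboundary of the
   context, see [form_of_coboundary]. *)
Definition cyccobnd psi x := cycsum (fun y => psi (mergeat 0 y)) x.

End Merge.

Local Notation merge := (mergeat *%g).
Local Notation cobnd := (cyccobnd *%g).

(** * The square of the coboundary, and the weighted splitting operator *)

Section Coboundary.
Local Open Scope ring_scope.
Variables (K : comPzRingType) (S : semigroupType).
Implicit Types (x y z t : seq S) (phi psi : seq S -> K).

(** Overlapping merges cancel by associativity. Disjoint merges with indices [i] and [m - 1 - i]
    agree up to a rotation and have opposite signs; as this reversal may fix a middle index, the sum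
    is shown equal to its own negative, whence the regularity of 2. *)
Lemma cobnd_cobnd m psi z : GRing.lreg (2%:R : K) ->
  cycfun m.+1 psi -> size z = m.+3 -> cobnd (cobnd psi) z = 0.
Proof.
move=> lreg2 cpsi sz; rewrite /cyccobnd.
pose E i y := (-1) ^+ (m.+1 * i.+1) * psi (merge 0 (rot i.+1 (merge 0 y))).
rewrite (@eq_cycsum _ _ _ (fun y => psi (merge 0 (merge 0 y)) + \sum_(i < m) E i y
    + E m y)); last first.
  move=> y; rewrite sz => sy; rewrite /cycsum size_merge0 ?sy //= big_ord_recl.
  rewrite rot0 muln0 mul1r big_ord_recr /= addrA; congr (_ + _ + _).
rewrite !cycsumD addrAC.
(* The last rotation puts the preceding letter [c] in front of [a * b]; by associativity this is the
   unrotated term of the word that starts at [c]. *)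
have -> : cycsum (E m) z = - cycsum (fun y => psi (merge 0 (merge 0 y))) z.
  rewrite -(@cycsum_shift _ _ (E m) z 1) ?sz // -cycsumN.
  apply: eq_cycsum => -[|c [|a [|b r]]]; rewrite sz //= => -[sr].
  rewrite rot1_cons /E /= -cats1 -cat_cons.
  have -> : m.+1 = size ((a * b)%g :: r) by rewrite /= sr.
  rewrite rot_size_cat /= mulgA mulrA -exprD /= sr -[RHS]mulN1r -[-1 in RHS]expr1.
  congr (_ * _); apply: eq_sign_odd; parity.
rewrite subrr add0r cycsum_sum.
apply: lreg2; rewrite mulr0 mulr2n mulrDl mul1r.
rewrite {1}(reindex_inj rev_ord_inj) -big_split big1 // => -[i im] _ /=.
have [j mE] : exists j, m = (i + j).+1 by exists (m - i.+1)%N; lia.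
have -> : (m - i.+1 = j)%N by lia.
rewrite -(@cycsum_shift _ _ (E j) z i.+2) ?sz; last by lia.
rewrite -cycsumD -(cycsum0 _ z); apply: eq_cycsum => y; rewrite sz => sy.
have [|u' [c [d [v [yE su]]]]] := @split_pair _ i.+2 y; first by rewrite sy; lia.
move: sy; rewrite yE {y yE}; case: u' su => [|a [|b u]] //= [su].
rewrite size_cat /= su mE => sv.
rewrite /E -su.
have -> : rot (size u).+2 [:: a, b & u ++ [:: c, d & v]] =
   [:: c, d & v ++ [:: a, b & u]] by exact: (rot_size_cat [:: a, b & u]).
have jv : j = size v by lia.
rewrite /= jv (rot_size_cat ((c * d)%g :: v)) (rot_size_cat ((a * b)%g :: u)) /=.
have -> : psi ((c * d)%g :: v ++ (a * b)%g :: u) =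
    (-1) ^+ (m * (size u).+1) * psi ((a * b)%g :: u ++ (c * d)%g :: v).
  rewrite -(cycfun_rot cpsi) /= ?size_cat /=; [|lia|lia].
  by rewrite (rot_size_cat ((a * b)%g :: u)).
rewrite !mulrA -!exprD mE -mulrDl.
set p := (X in (-1) ^+ X + _); set q := (X in _ + (-1) ^+ X).
have -> : (-1) ^+ p = - (-1) ^+ q :> K.
  rewrite -[RHS]mulN1r -exprS; apply: eq_sign_odd; rewrite /p /q jv -su; parity.
by rewrite addNr mul0r.
Qed.

Variables (e : S -> S) (w : seq S -> K).
Hypothesis splitK : forall a, (a * e a * (e a * a) = a)%g.

Definition splithead x := if x is a :: t then (a * e a)%g :: (e a * a)%g :: t else x.

Definition contract phi x := cycsum (fun y => w y * phi (splithead y)) x.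

Lemma splithead_cons a t : splithead (a :: t) = (a * e a)%g :: (e a * a)%g :: t.
Proof. by []. Qed.

(** The faces that touch a split entry: here its right half is merged with the next letter, in
    [merge_splitr] its left half with the preceding one. *)
Definition merge_splitl x :=
  if x is a :: b :: t then (a * e a)%g :: (e a * (a * b))%g :: t else x.
Definition merge_splitr x :=
  if x is a :: b :: t then (a * b * e b)%g :: (e b * b)%g :: t else x.

(* This is [dh + hd], as [hd phi = 0]: splitting one entry and merging two distant
   ones commute up to the change in the weight [w]. *)
Lemma cobnd_contract m phi x : cycfun m.+2 phi ->
  (forall z, size z = m.+3 -> cobnd phi z = 0) -> size x = m.+2 ->
  cobnd (contract phi) x =
    cycsum (fun y => w y * phi y - w y * phi (merge_splitl y)
       - w (rot 1 y) * phi (merge_splitr y) + w (merge 0 y) * phi (splithead (merge 0 y))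
       + \sum_(j < m) (-1) ^+ j * (w y - w (merge j.+1 y)) *
            phi (splithead (merge j.+1 y))) x.
Proof.
move=> cphi dphi sx.
pose A i y := (-1) ^+ (m * i.+1) * (w (rot i.+1 (merge 0 y)) *
   phi (splithead (rot i.+1 (merge 0 y)))).
have -> : cobnd (contract phi) x = cycsum (fun y =>
    w (merge 0 y) * phi (splithead (merge 0 y)) + \sum_(i < m) A i y) x.
  apply: eq_cycsum => y; rewrite sx => sy.
  rewrite /contract /cycsum size_merge0 ?sy //= big_ord_recl rot0 muln0 mul1r.
  by congr (_ + _); apply: eq_bigr => i _; rewrite /bump leq0n add1n.
have E0 : cycsum (fun y => w y * cobnd phi (splithead y)) x = 0.
  rewrite -(cycsum0 _ x); apply: eq_cycsum => -[|a t]; rewrite sx // => sy.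
  by rewrite dphi ?mulr0 //= -sy.
pose B y := \sum_(j < m) (-1) ^+ j * (w y * phi (splithead (merge j.+1 y))).
pose L y := (-1) ^+ m * (w y * phi (merge 0 (rot m.+2 (splithead y)))).
(* The faces of the split word in order: the two halves reunited, the right half merged with the
   next letter, the distant merges [B], and the last letter merged with the left half, [L]. *)
have EB : cycsum (fun y => w y * phi y - w y * phi (merge_splitl y) + B y + L y) x = 0.
  rewrite -E0; apply: eq_cycsum => -[|a [|b t]]; rewrite sx // => -[st].
  rewrite /cyccobnd /cycsum splithead_cons [size _]/= st /bump.
  rewrite 2!big_ord_recl big_ord_recr ![nat_of_ord _]/=.
  rewrite !mulrDr -!addrA; congr (_ + (_ + (_ + _))).
  - by rewrite rot0 /= splitK muln0 mul1r.
  - rewrite /bump leq0n addn0 rot1_cons muln1.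
    rewrite -[merge 0 _]/(rcons ((e a * a * b)%g :: t) (a * e a)%g).
    have <- : rot 1 [:: a * e a, e a * (a * b) & t]%g =
              rcons [:: (e a * a * b)%g & t] (a * e a)%g by rewrite rot1_cons mulgA.
    rewrite cphi ?[size _]/= ?st // -mulrN; congr (_ * _).
    by rewrite exprS mulN1r mulNr signrMK.
  - rewrite /B mulr_sumr; apply: eq_bigr => i _; rewrite !lift0 [nat_of_ord (widen_ord _ _)]/=.
    move: (nat_of_ord i) (ltn_ord i) => {}i im.
    have [|u [c [d [v [tE su]]]]] := @split_pair _ i (b :: t); first by rewrite /= st; lia.
    have: size (b :: t) = m.+1 by rewrite /= st.
    rewrite tE size_cat /= => sv.
    rewrite /= -su mergeat_cat.
    rewrite (rot_size_cat [:: (a * e a)%g, (e a * a)%g & u]).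
    rewrite [phi _ in RHS]/=  -[phi (_ :: v ++ _)]/(phi (((c * d)%g :: v) ++ [:: (a * e a)%g, (e a * a)%g & u])).
    rewrite -(rot_size_cat [:: (a * e a)%g, (e a * a)%g & u] ((c * d)%g :: v)).
    rewrite (cycfun_rot cphi) /= ?size_cat /=; [|lia|lia].
    rewrite mulrCA; congr (_ * _); rewrite mulrA -exprD; congr (_ * _).
    by apply: eq_sign_odd; parity.
  - rewrite /bump !leq0n !add1n /L mulrCA; congr (_ * (_ * _)).
    by apply: eq_sign_odd; parity.
(* After a shift by one the word starts with the letter before the split one, so the weight is read
   off at [rot 1 y]. *)
have EL : cycsum L x = - cycsum (fun y => w (rot 1 y) * phi (merge_splitr y)) x.
  rewrite -(@cycsum_shift _ _ L x 1) ?sx // -cycsumN.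
  apply: eq_cycsum => -[|c [|a r]]; rewrite sx //= => -[sr].
  rewrite /L rot1_cons /= -cats1.
  have -> : m.+2 = size [:: (a * e a)%g, (e a * a)%g & r] by rewrite /= sr.
  rewrite (rot_size_cat [:: (a * e a)%g, (e a * a)%g & r]) /=.
  rewrite muln1 mulrA -exprD mulgA -[RHS]mulN1r; congr (_ * _).
  by rewrite -[RHS]expr1; apply: eq_sign_odd; parity.
(* [A] merges at the head and splits elsewhere. Rotating the letter to be split to the front moves
   the merge to position [j.+1] and reverses the index. *)
have EA : cycsum (fun y => \sum_(i < m) A i y) x =
   - cycsum (fun y => \sum_(j < m) (-1) ^+ j * (w (merge j.+1 y) * phi (splithead (merge j.+1 y)))) x.
  rewrite !cycsum_sum -sumrN (reindex_inj rev_ord_inj).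
  apply: eq_bigr => -[i im] _ /=.
  have [j mE] : exists j, m = (i + j).+1 by exists (m - i.+1)%N; lia.
  have -> : (m - i.+1 = j)%N by lia.
  rewrite -(@cycsum_shift _ _ (A j) x i.+1) ?sx; last by lia.
  rewrite -cycsumN; apply: eq_cycsum => -[|a t]; rewrite sx // => -[st].
  have [|u [c [d [v [tE su]]]]] := @split_pair _ i t; first by rewrite st; lia.
  move: st; rewrite tE size_cat /= su mE => sv.
  rewrite /A -su; have jv : j = size v by lia.
  rewrite (rot_size_cat (a :: u) [:: c, d & v]) /= jv.
  rewrite (rot_size_cat ((c * d)%g :: v)) mergeat_cat.
  rewrite mulrA -exprD -mulNr; congr (_ * _).
  by rewrite -[RHS]mulN1r -exprS mE -su jv; apply: eq_sign_odd; parity.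
have ER y : \sum_(j < m) (-1) ^+ j * (w y - w (merge j.+1 y)) * phi (splithead (merge j.+1 y))
  = B y - \sum_(j < m) (-1) ^+ j * (w (merge j.+1 y) * phi (splithead (merge j.+1 y))).
  by rewrite -sumrB; apply: eq_bigr => j _; rewrite -mulrA mulrBl mulrBr.
rewrite (eq_cycsum (x := x) (fun y _ => congr1 _ (ER y))).
rewrite cycsumD EA -[LHS]addr0 -[X in _ + X]EB !cycsumD EL !cycsumN; ring.
Qed.
End Coboundary.

(** * The potential *)

Section Potential.
Local Open Scope ring_scope.
Local Open Scope set_scope.
Variables (S : semigroupType) (idem : forall x : S, (x * x = x)%g).
Implicit Types (a b c d p z : S) (x y t : seq S).

Notation "x <<= y" := (bandle x y) (at level 70).
Notation "x ~~ y" := (bandeq x y) (at level 70).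
Local Notation le_trans := (bandle_trans idem).

Definition bandmin z x := all (fun b => (b <<= z) ==> (z <<= b)) x.

Lemma bandminP z x :
  reflect (forall b, b \in x -> b <<= z -> z <<= b) (bandmin z x).
Proof.
by apply: (iffP allP) => h b bx; [move=> bz; have := h b bx; rewrite bz | apply/implyP/h].
Qed.

Lemma bandmin_cons z c x :
  bandmin z (c :: x) = ((c <<= z) ==> (z <<= c)) && bandmin z x.
Proof. by []. Qed.

Lemma bandmin_mem z x y : x =i y -> bandmin z x = bandmin z y.
Proof. by move=> xy; exact: (eq_all_r xy). Qed.

Lemma bandmin_eqv z z' x : z ~~ z' -> bandmin z x = bandmin z' x.
Proof.
by move=> h; apply: eq_all => b /=; rewrite (bandeq_ler idem _ h) (bandeq_lel idem _ h).
Qed.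

Lemma ex_bandmin x : x != [::] -> exists2 z, z \in x & bandmin z x.
Proof.
elim: x => // a [|b x] IH _.
  by exists a; rewrite ?mem_head //= bandlexx.
have [//|z zx zmin] := IH.
have [/andP[az nza]|az] := boolP ((a <<= z) && ~~ (z <<= a)).
  exists a; rewrite ?mem_head // bandmin_cons (bandlexx idem) implybT.
  apply/bandminP => c cx ca; apply: (le_trans az).
  by move/bandminP: zmin; apply=> //; apply: le_trans ca az.
exists z; first by rewrite inE zx orbT.
rewrite bandmin_cons zmin andbT; apply/implyP => h.
by move: az; rewrite h /= negbK.
Qed.

Variables (I : finType) (g : I -> S).

(* [z] is the meet of the [g i] above it, as are the elements of the semilattice
   generated by the [g i]. *)
Definition meetlike z :=
  forall p, (forall i, z <<= g i -> p <<= g i) -> p <<= z.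

Lemma meetlike_gen i : meetlike (g i).
Proof. by move=> p; apply; rewrite bandlexx. Qed.

Lemma meetlike_eqv z z' : z ~~ z' -> meetlike z -> meetlike z'.
Proof.
move=> zz mz p h; rewrite -(bandeq_ler idem _ zz); apply: mz => i.
by rewrite (bandeq_lel idem _ zz); apply: h.
Qed.

Lemma meetlike_mul a b : meetlike a -> meetlike b -> meetlike (a * b)%g.
Proof.
move=> ma mb p h; rewrite bandle_mulE //; apply/andP; split.
  by apply: ma => i ai; apply: h; apply: le_trans ai; apply: bandle_mull.
by apply: mb => i ai; apply: h; apply: le_trans ai; apply: bandle_mulr.
Qed.

(** Measures how far down the word reaches: a set of indices counts once some single entry lies
    below all its generators. The measure is at most [2 ^ #|I|], however large [S] is. *)
Definition upsets x : {set {set I}} :=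
  [set A : {set I} | has (fun z => [forall i in A, z <<= g i]) x].

Lemma upsetsP x (A : {set I}) :
  reflect (exists2 z, z \in x & forall i, i \in A -> z <<= g i) (A \in upsets x).
Proof.
rewrite inE; apply: (iffP hasP) => -[z zx h]; exists z => //.
  by move=> i iA; move/forallP: h => /(_ i); rewrite iA.
by apply/forallP => i; apply/implyP => /h.
Qed.

Definition refines x y := forall z, z \in x -> exists2 z', z' \in y & z' <<= z.

Lemma upsets_sub x y : refines x y -> upsets x \subset upsets y.
Proof.
move=> xy; apply/fintype.subsetP => A /upsetsP[z zx zA].
have [z' z'y z'z] := xy z zx; apply/upsetsP; exists z' => // i iA.
exact: le_trans z'z (zA i iA).
Qed.

(** The new member is the set of all generators above [p]: an entry of [x] below all of them would
    lie below [p], as [p] is their meet. *)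
Lemma upsets_proper x y p : refines x y -> p \in y -> meetlike p ->
  (forall z, z \in x -> ~~ (z <<= p)) -> upsets x \proper upsets y.
Proof.
move=> xy py mp xp; rewrite properE upsets_sub //=; apply/fintype.subsetPn.
exists [set i | p <<= g i].
  by apply/upsetsP; exists p => // i; rewrite inE.
apply/negP => /upsetsP[z zx zA]; have := xp z zx; rewrite mp // => i pi.
by apply: zA; rewrite inE.
Qed.

Definition numin x := count (fun z => bandmin z x) x.

(** With e the common representative of the class, these are the pairs fixed by the move from (a, b)
    to (a e, e b), which occurs in [phi_rectangular]. *)
Definition fixedpair (q : S * S) :=
  [&& q.1 ~~ q.2, q.1 == (q.1 * rep q.1)%g & q.2 == (rep q.2 * q.2)%g].

Definition numfixed x := count fixedpair (zip x (rot 1 x)).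

(* Encodes the lexicographic order on the three counts, the last two being at most
   [size x]. *)
Definition potential x :=
  (#|upsets x| * (size x).+1 ^ 2 + numin x * (size x).+1 + numfixed x)%N.

Lemma numin_size x : (numin x <= size x)%N.
Proof. exact: count_size. Qed.

Lemma numfixed_size x : (numfixed x <= size x)%N.
Proof.
apply: leq_trans (count_size _ _) _; by rewrite size_zip geq_minl.
Qed.

Lemma potential_bound x :
  (potential x < (2 ^ #|I|).+1 * (size x).+1 ^ 2)%N.
Proof.
have := numin_size x; have := numfixed_size x.
have : (#|upsets x| <= 2 ^ #|I|)%N.
  rewrite -cardsT -card_powerset subset_leq_card //.
  by apply/fintype.subsetP => A _; rewrite powersetE finset.subsetT.
rewrite /potential; nia.
Qed.

Lemma potential_upsets x y : size x = size y ->
  upsets x \proper upsets y -> (potential x < potential y)%N.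
Proof.
move=> sxy /proper_card; have := numin_size x; have := numfixed_size x.
rewrite /potential sxy; nia.
Qed.

Lemma potential_numin x y : size x = size y ->
  upsets x \subset upsets y -> (numin x < numin y)%N ->
  (potential x < potential y)%N.
Proof.
move=> sxy /subset_leq_card; have := numfixed_size x.
rewrite /potential sxy; nia.
Qed.

Lemma potential_numfixed x y : size x = size y ->
  upsets x \subset upsets y -> (numin x <= numin y)%N ->
  (numfixed x < numfixed y)%N -> (potential x < potential y)%N.
Proof.
by move=> sxy /subset_leq_card; rewrite /potential sxy; nia.
Qed.

Lemma numfixed_rot1 x : numfixed (rot 1 x) = numfixed x.
Proof.
case: x => [|a [|b t]] //; rewrite /numfixed !rot1_cons.
rewrite -[RHS]/(count fixedpair ((a, b) :: zip (b :: t) (rcons t a))).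
rewrite -[LHS]/(count fixedpair (zip (rcons (b :: t) a) (rcons (rcons t a) b))).
by rewrite zip_rcons ?size_rcons // -cats1 count_cat /= addn0 addnC.
Qed.

Lemma potential_rot1 x : potential (rot 1 x) = potential x.
Proof.
rewrite /potential size_rot numfixed_rot1; congr (_ * _ + _ * _ + _)%N.
  congr #|pred_of_set _|; apply/setP => A; rewrite !inE.
  by apply: eq_has_r => z; rewrite mem_rot.
rewrite /numin; have -> : count (fun z => bandmin z (rot 1 x)) (rot 1 x) =
    count (fun z => bandmin z x) (rot 1 x).
  by apply: eq_count => z; apply: bandmin_mem => b; rewrite mem_rot.
by apply/permP; rewrite perm_rot.
Qed.

Lemma potential_rot k x : potential (rot k x) = potential x.
Proof.
have [kx|xk] := leqP k (size x); last by rewrite rot_oversize // ltnW.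
elim: k kx => [|k IH] kx; first by rewrite rot0.
by rewrite -add1n rotD // potential_rot1 IH // ltnW.
Qed.

(** An entry of [x] below [p] would lie below the minimal [a], hence be equivalent to [a], and then
    [a] would lie below [p]. So [p] is lower than anything in [x] can witness. *)
Lemma potential_strict x y a p : size x = size y -> refines x y ->
  p \in y -> meetlike p -> a \in x -> bandmin a x -> p <<= a -> ~~ (a <<= p) ->
  (potential x < potential y)%N.
Proof.
move=> sxy xy py mp ax /bandminP amin pa ap; apply: potential_upsets => //.
apply: (upsets_proper xy py mp) => z zx; apply: contra ap => zp.
apply: (le_trans _ zp); apply: amin => //; exact: le_trans zp pa.
Qed.

End Potential.

(** * The homotopy *)

Section BandHomotopy.
Local Open Scope ring_scope.
Variables (K : numFieldType) (S : semigroupType).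
Hypothesis idem : forall x : S, (x * x = x)%g.
Implicit Types (a b c d p z : S) (x y t : seq S) (phi psi : seq S -> K).

Notation "x <<= y" := (bandle x y) (at level 70).
Notation "x ~~ y" := (bandeq x y) (at level 70).

Lemma bandeq_mulrep a : (a * rep a)%g ~~ a.
Proof. by apply: bandeq_mull => //; case/andP: (bandeq_rep idem a). Qed.

Lemma bandeq_repmul a : (rep a * a)%g ~~ a.
Proof. by apply: bandeq_mulr => //; case/andP: (bandeq_rep idem a). Qed.

Lemma mulrepK a : (a * rep a * (rep a * a) = a)%g.
Proof. by rewrite mulgA -(mulgA a) idem band_rectL ?bandeq_rep. Qed.

Definition minhead x : K := if x is a :: _ then (bandmin a x)%:R else 0.

(** The coefficient of [phi x] that survives in [minhead_homotopy]. *)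
Definition unsettled x :=
  if x is [:: a, b & _] then bandmin a x && ~~ fixedpair (a, b) else false.

Lemma refines_pair a b p q t : (p <<= a) || (q <<= a) -> (p <<= b) || (q <<= b) ->
  refines [:: a, b & t] [:: p, q & t].
Proof.
have h z : (p <<= z) || (q <<= z) -> exists2 z', z' \in [:: p, q & t] & z' <<= z.
  by case/orP; [exists p | exists q]; rewrite ?inE ?eqxx ?orbT.
move=> pa pb z; rewrite !inE => /or3P[/eqP-> | /eqP-> | zt]; try exact: h.
by exists z; rewrite ?inE ?zt ?orbT ?bandlexx.
Qed.

(** These lists run through the cyclically adjacent pairs of [[:: a, b & t]] other than [(a, b)]
    itself. *)
Lemma fixedpair_mono a a' b b' t :
  (forall c, fixedpair (b, c) -> fixedpair (b', c)) ->
  (forall c, fixedpair (c, a) -> fixedpair (c, a')) ->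
  (count (@fixedpair S) (zip (b :: t) (rcons t a)) <=
     count (@fixedpair S) (zip (b' :: t) (rcons t a')))%N.
Proof.
move=> fb fa; elim: t b b' fb => [|c t IH] b b' fb.
  by rewrite /= !addn0; case h: (fixedpair (b, a)); rewrite // fa ?fb.
rewrite !rcons_cons.
apply: (@leq_add _ _ (fixedpair (b', c)) _ _ (IH c c (fun _ => id))).
by case h: (fixedpair (b, c)); rewrite // fb.
Qed.

(** * The terms of the homotopy at one word *)

Section Step.
Variables (I : finType) (g : I -> S) (m : nat) (phi : seq S -> K) (x : seq S).
Local Notation mem_meetlike y := (forall z, z \in y -> meetlike g z).
Hypothesis sx : size x = m.+2.
Hypothesis mx : mem_meetlike x.
Hypothesis phi0 : forall y, size y = m.+2 -> mem_meetlike y ->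
  (potential g x < potential g y)%N -> phi y = 0.

Let meetlike_mulrep a : meetlike g a -> meetlike g (a * rep a)%g.
Proof. by apply: meetlike_eqv => //; rewrite bandeq_sym bandeq_mulrep. Qed.

Let meetlike_repmul a : meetlike g a -> meetlike g (rep a * a)%g.
Proof. by apply: meetlike_eqv => //; rewrite bandeq_sym bandeq_repmul. Qed.

(** The merged letter lies below both [a] and [b], hence strictly below the minimal entry [a], and
    the word reaches deeper. *)
Lemma splitl_eq0 a b t : x = [:: a, b & t] -> bandmin a x -> ~~ (a <<= b) ->
  phi (merge_splitl rep x) = 0.
Proof.
move=> xE amin ab; have ma : meetlike g a by apply: mx; rewrite xE mem_head.
have mb : meetlike g b by apply: mx; rewrite xE !inE eqxx orbT.
have mp : meetlike g (rep a * (a * b))%g.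
  rewrite mulgA; apply: meetlike_mul => //; exact: meetlike_repmul.
have pa : (rep a * (a * b))%g <<= a.
  by rewrite mulgA (bandle_trans idem (bandle_mull idem _ _)) // bandle_mulr.
have pb : (rep a * (a * b))%g <<= b by rewrite mulgA bandle_mulr.
apply: phi0; first by move: sx; rewrite xE.
  rewrite xE /= => z; rewrite !inE => /or3P[/eqP->|/eqP->|zt].
  - exact: meetlike_mulrep.
  - by [].
  - by apply: mx; rewrite xE !inE zt !orbT.
apply: (potential_strict idem (a := a) (p := (rep a * (a * b))%g)) => //.
- by rewrite xE.
- by rewrite xE; apply: refines_pair; rewrite ?pa ?pb orbT.
- by rewrite xE /= !inE eqxx orbT.
- by rewrite xE mem_head.
- by apply: contra ab => /(bandle_trans idem)->.
Qed.

Lemma splitr_eq0 a b t : x = [:: a, b & t] -> bandmin b x -> ~~ (b <<= a) ->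
  phi (merge_splitr rep x) = 0.
Proof.
move=> xE bmin ba; have ma : meetlike g a by apply: mx; rewrite xE mem_head.
have mb : meetlike g b by apply: mx; rewrite xE !inE eqxx orbT.
have mp : meetlike g (a * b * rep b)%g.
  rewrite -mulgA; apply: meetlike_mul => //; exact: meetlike_mulrep.
have pa : (a * b * rep b)%g <<= a by rewrite -mulgA bandle_mull.
have pb : (a * b * rep b)%g <<= b.
  by rewrite (bandle_trans idem (bandle_mull idem _ _)) // bandle_mulr.
apply: phi0; first by move: sx; rewrite xE.
  rewrite xE /= => z; rewrite !inE => /or3P[/eqP->|/eqP->|zt].
  - by [].
  - exact: meetlike_repmul.
  - by apply: mx; rewrite xE !inE zt !orbT.
apply: (potential_strict idem (a := b) (p := (a * b * rep b)%g)) => //.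
- by rewrite xE.
- by rewrite xE; apply: refines_pair; rewrite ?pa ?pb.
- by rewrite xE /= !inE eqxx.
- by rewrite xE !inE eqxx orbT.
- by apply: contra ba => /(bandle_trans idem)->.
Qed.

(** If no entry of [x] lies below [a * b], the new word reaches deeper. Otherwise such an entry [z]
    is in [t] and equivalent to [a * b]; then neither [a] nor [b] was minimal, both halves of
    [a * b] are, and minimal entries of [t] stay minimal, so the number of minimal entries grows. *)
Lemma splithead_merge_eq0 a b t : x = [:: a, b & t] -> ~~ (a <<= b) -> ~~ (b <<= a) ->
  bandmin (a * b)%g (a * b :: t)%g -> phi (splithead rep (a * b :: t)%g) = 0.
Proof.
move=> xE ab ba pmin; have ma : meetlike g a by apply: mx; rewrite xE mem_head.
have mb : meetlike g b by apply: mx; rewrite xE !inE eqxx orbT.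
have mab := meetlike_mul idem ma mb.
have pa : (a * b)%g <<= a by rewrite bandle_mull.
have pb : (a * b)%g <<= b by rewrite bandle_mulr.
set p := (a * b)%g in pmin mab pa pb *.
have [l1 l2] : p * rep p ~~ p /\ rep p * p ~~ p by rewrite bandeq_mulrep bandeq_repmul.
apply: phi0; first by move: sx; rewrite xE.
  rewrite /= => z; rewrite !inE => /or3P[/eqP->|/eqP->|zt].
  - exact: meetlike_mulrep.
  - exact: meetlike_repmul.
  - by apply: mx; rewrite xE !inE zt !orbT.
have ref : refines x (splithead rep (p :: t)).
  by rewrite xE; apply: refines_pair; rewrite (bandeq_lel idem _ l1) ?pa ?pb.
have [/hasP[z zx zp]|] := boolP (has (fun z => z <<= p) x); last first.
  move=> /hasPn xp; apply: potential_upsets; first by rewrite xE.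
  apply: (upsets_proper idem ref (p := (p * rep p)%g)); rewrite ?mem_head //.
    exact: meetlike_mulrep.
  by move=> z zx; rewrite (bandeq_ler idem _ l1) xp.
have napx : ~~ (a <<= p) by rewrite bandle_mulE // bandlexx.
have nbpx : ~~ (b <<= p) by rewrite bandle_mulE // bandlexx ?andbT.
have zt : z \in t.
  move: zx; rewrite xE !inE => /or3P[/eqP zE|/eqP zE|//].
    by rewrite -zE zp in napx.
  by rewrite -zE zp in nbpx.
have pz : p <<= z by move/bandminP: pmin; apply; rewrite ?inE ?zt ?orbT.
apply: potential_numin; rewrite ?xE //; first by rewrite -xE upsets_sub.
have amin : bandmin a x = false.
  apply/negP => /bandminP/(_ z zx); rewrite (bandle_trans idem zp pa) => /(_ isT) az.
  by rewrite (bandle_trans idem az zp) in napx.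
have bmin : bandmin b x = false.
  apply/negP => /bandminP/(_ z zx); rewrite (bandle_trans idem zp pb) => /(_ isT) bz.
  by rewrite (bandle_trans idem bz zp) in nbpx.
have pmin' : bandmin p (splithead rep (p :: t)).
  rewrite /splithead !bandmin_cons (bandeq_lel idem _ l1) (bandeq_lel idem _ l2).
  rewrite (bandeq_ler idem _ l1) (bandeq_ler idem _ l2) bandlexx //=.
  by case/andP: pmin.
rewrite -xE; set y := splithead rep (p :: t) in ref pmin' *.
have -> : numin x = count (fun z => bandmin z x) t.
  by rewrite /numin [X in count _ X]xE /= amin bmin.
have -> : numin y = (count (fun z => bandmin z y) t).+2.
  rewrite -[LHS]/(bandmin (p * rep p)%g y + (bandmin (rep p * p)%g y + count _ t))%N.
  rewrite (bandmin_eqv idem _ l1) (bandmin_eqv idem _ l2).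
  by rewrite pmin'.
rewrite ltnS; apply: leqW; apply: sub_count => c /bandminP cmin.
apply/bandminP => d; rewrite !inE => /or3P[/eqP->|/eqP->|dt dc].
- rewrite (bandeq_lel idem _ l1) (bandeq_ler idem _ l1) => pc.
  by apply: (bandle_trans idem _ zp); apply: cmin => //; apply: (bandle_trans idem zp pc).
- rewrite (bandeq_lel idem _ l2) (bandeq_ler idem _ l2) => pc.
  by apply: (bandle_trans idem _ zp); apply: cmin => //; apply: (bandle_trans idem zp pc).
- by apply: cmin => //; rewrite xE !inE dt !orbT.
Qed.

(** A fixed pair leaves the word as it is. Otherwise depth and minimal entries do not decrease, the
    pair becomes fixed and no other fixed pair is lost, so the third count grows. *)
Lemma phi_rectangular a b t : x = [:: a, b & t] -> a ~~ b ->
  phi [:: a * rep a, rep a * b & t]%g = (fixedpair (a, b))%:R * phi x.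
Proof.
move=> xE ab; have eab := eq_rep idem ab.
have ma : meetlike g a by apply: mx; rewrite xE mem_head.
have mb : meetlike g b by apply: mx; rewrite xE !inE eqxx orbT.
have l1 := bandeq_mulrep a; have l2 := bandeq_repmul b.
rewrite eab in l1 *.
have [/and3P[_ /= /eqP aE /eqP bE]|nfix] := boolP (fixedpair (a, b)).
  by rewrite mul1r -eab -aE eab -bE xE.
rewrite mul0r; apply: phi0; first by move: sx; rewrite xE.
  move=> z; rewrite !inE => /or3P[/eqP->|/eqP->|zt].
  - by rewrite -eab; apply: meetlike_mulrep.
  - exact: meetlike_repmul.
  - by apply: mx; rewrite xE !inE zt !orbT.
set y := [:: _, _ & t].
have min_eq z : bandmin z y = bandmin z x.
  rewrite xE !bandmin_cons (bandeq_lel idem _ l1) (bandeq_lel idem _ l2).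
  by rewrite (bandeq_ler idem _ l1) (bandeq_ler idem _ l2).
apply: potential_numfixed.
- by rewrite xE.
- by apply: upsets_sub => //; rewrite xE; apply: refines_pair;
    rewrite ?(bandeq_lel idem _ l1) ?(bandeq_lel idem _ l2) bandlexx ?orbT.
- rewrite /numin (eq_count min_eq) [X in (count _ X <= _)%N]xE /=.
  by rewrite (bandmin_eqv idem _ l1) (bandmin_eqv idem _ l2).
rewrite xE /numfixed !rot1_cons.
rewrite -[X in (X < _)%N]/(fixedpair (a, b) + count _ (zip (b :: t) (rcons t a)))%N.
rewrite -[X in (_ < X)%N]/(fixedpair (a * rep b, rep b * b)%g +
  count _ (zip ((rep b * b)%g :: t) (rcons t (a * rep b)%g)))%N.
have fx : fixedpair (a * rep b, rep b * b)%g.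
  rewrite /fixedpair /= (eq_rep idem l1) (eq_rep idem l2) eab mulgA idem -mulgA idem !eqxx.
  rewrite !andbT; apply: bandeq_trans l1 _ => //; apply: bandeq_trans ab _ => //.
  by rewrite bandeq_sym.
rewrite (negbTE nfix) fx add0n add1n ltnS; apply: fixedpair_mono => c.
  rewrite /fixedpair /= (eq_rep idem l2) => /and3P[bc /eqP bE cE].
  rewrite cE (bandeq_trans idem l2 bc) -mulgA -bE eqxx //.
rewrite /fixedpair /= (eq_rep idem l1) => /and3P[ca cE /eqP aE].
by rewrite cE (bandeq_trans idem ca) 1?bandeq_sym // mulgA -aE eqxx.
Qed.

(** Merging never raises a letter, so a head that is minimal afterwards was minimal before. If the
    weight changes, [c * d] therefore lies strictly below the minimal head [a]. *)
Lemma splithead_merge_far_eq0 a t j : x = a :: t -> (j < m)%N ->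
  minhead x != minhead (merge j.+1 x) -> phi (splithead rep (merge j.+1 x)) = 0.
Proof.
move=> xE jm; have [|u [c [d [v [tE su]]]]] := @split_pair _ j t.
  by move: sx; rewrite xE /= => -[->].
set y := merge j.+1 x => neq.
have yE : y = a :: u ++ (c * d)%g :: v by rewrite /y xE tE /= -su mergeat_cat.
have ma : meetlike g a by apply: mx; rewrite xE mem_head.
have mc : meetlike g c by apply: mx; rewrite xE tE !inE mem_cat !inE eqxx !orbT.
have md : meetlike g d by apply: mx; rewrite xE tE !inE mem_cat !inE eqxx !orbT.
have mcd := meetlike_mul idem mc md.
have cdc : (c * d)%g <<= c by rewrite bandle_mull.
have cdd : (c * d)%g <<= d by rewrite bandle_mulr.
have memy z : z \in y -> (z == (c * d)%g) || (z \in x).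
  rewrite yE xE tE !inE !mem_cat !inE => /or3P[->|->|/orP[->|->]];
  by rewrite ?orbT.
have amin : bandmin a y -> bandmin a x.
  move=> /bandminP amin; have mem_p : (c * d)%g \in y by rewrite yE inE mem_cat mem_head !orbT.
  apply/bandminP => z; rewrite xE tE inE mem_cat !inE => zx.
  case/or3P: zx => [/eqP->|zu|/or3P[/eqP->|/eqP->|zv]] za.
  - exact: bandlexx.
  - by apply: amin za; rewrite yE inE mem_cat zu !orbT.
  - by apply: (bandle_trans idem _ cdc); apply: amin => //; apply: (bandle_trans idem cdc za).
  - by apply: (bandle_trans idem _ cdd); apply: amin => //; apply: (bandle_trans idem cdd za).
  - by apply: amin za; rewrite yE inE mem_cat inE zv !orbT.
have {}amin : bandmin a x && ~~ bandmin a y.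
  move: neq amin; have -> : minhead x = (bandmin a x)%:R by rewrite xE.
  have -> : minhead y = (bandmin a y)%:R by rewrite yE.
  by case: (bandmin a x); case: (bandmin a y); rewrite ?eqxx // => _ /(_ isT).
case/andP: amin => amin /allPn[q /memy qy]; rewrite negb_imply => /andP[qa naq].
have [pa na] : (c * d)%g <<= a /\ ~~ (a <<= (c * d)%g).
  case/orP: qy => [/eqP <- //|qx].
  by move/bandminP: amin => /(_ q qx qa); rewrite (negbTE naq).
have l1 := bandeq_mulrep a; have l2 := bandeq_repmul a.
rewrite yE; apply: phi0.
- by move: sx; rewrite xE tE /= !size_cat /= !addnS.
- move=> z; rewrite !inE => /or3P[/eqP->|/eqP->|].
  + exact: meetlike_mulrep.
  + exact: meetlike_repmul.
  + rewrite mem_cat inE => /or3P[zu|/eqP->//|zv];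
      by apply: mx; rewrite xE tE inE mem_cat !inE ?zu ?zv ?orbT.
apply: (potential_strict idem (a := a) (p := (c * d)%g)) => //.
- by rewrite xE tE /= !size_cat /= !addnS.
- move=> z; rewrite xE tE inE mem_cat !inE => /or3P[/eqP->|zu|/or3P[/eqP->|/eqP->|zv]].
  + by exists (a * rep a)%g; rewrite ?mem_head // (bandeq_lel idem _ l1) bandlexx.
  + by exists z; rewrite ?bandlexx // !inE mem_cat zu !orbT.
  + by exists (c * d)%g; rewrite // !inE mem_cat mem_head !orbT.
  + by exists (c * d)%g; rewrite // !inE mem_cat mem_head !orbT.
  + by exists z; rewrite ?bandlexx // !inE mem_cat inE zv !orbT.
- by rewrite /= !inE mem_cat mem_head !orbT.
- by rewrite xE mem_head.
Qed.

(** If exactly one of [a <<= b] and [b <<= a] holds, the term that merges first cancels the term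
    that splits the lower letter, and the other one vanishes. If [a ~~ b], the three terms have
    equal weight and the same word, so one copy survives and [phi_rectangular] evaluates it. If [a]
    and [b] are incomparable, all three vanish. *)
Lemma minhead_homotopy :
  minhead x * phi x - minhead x * phi (merge_splitl rep x)
    - minhead (rot 1 x) * phi (merge_splitr rep x)
    + minhead (merge 0 x) * phi (splithead rep (merge 0 x))
    + \sum_(j < m) (-1) ^+ j * (minhead x - minhead (merge j.+1 x)) *
         phi (splithead rep (merge j.+1 x)) =
  (unsettled x)%:R * phi x.
Proof.
rewrite [X in _ + X = _]big1 ?addr0; last first.
  move=> j _; have [->|neq] := eqVneq (minhead x) (minhead (merge j.+1 x)).
    by rewrite subrr mulr0 mul0r.
  case xE: x neq => [|a t]; first by rewrite /= eqxx.
  by rewrite -xE => neq; rewrite (splithead_merge_far_eq0 xE) ?mulr0.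
have [a [b [t xE]]] : exists a b t, x = [:: a, b & t].
  by move: sx; case: x => [|a [|b t]] // _; exists a, b, t.
have -> : minhead x = (bandmin a x)%:R by rewrite xE.
have -> : minhead (rot 1 x) = (bandmin b x)%:R.
  rewrite (@bandmin_mem _ b x (rot 1 x)); first by rewrite xE rot1_cons.
  by move=> z; rewrite mem_rot.
have -> : unsettled x = bandmin a x && ~~ fixedpair (a, b) by rewrite xE.
have mE : merge 0 x = (a * b)%g :: t by rewrite xE.
have wE : minhead (merge 0 x) = (bandmin (a * b)%g (a * b :: t)%g)%:R by rewrite mE.
have lE : merge_splitl rep x = [:: a * rep a, rep a * (a * b) & t]%g by rewrite xE.
have rE : merge_splitr rep x = [:: a * b * rep b, rep b * b & t]%g by rewrite xE.
have sE : splithead rep (merge 0 x) =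
    [:: a * b * rep (a * b), rep (a * b) * (a * b) & t]%g by rewrite mE.
have ra := bandeq_rep idem a; have rb := bandeq_rep idem b.
have wleft : a <<= b -> bandmin (a * b)%g (a * b :: t)%g = bandmin a x.
  move=> ab; rewrite (bandmin_eqv idem _ (bandeq_mull idem ab)) xE !bandmin_cons.
  by rewrite bandle_mulE // bandlexx // ab !implybT.
have wright : b <<= a -> bandmin (a * b)%g (a * b :: t)%g = bandmin b x.
  move=> ba; rewrite (bandmin_eqv idem _ (bandeq_mulr idem ba)) xE !bandmin_cons.
  by rewrite bandle_mulE // bandlexx // ba !implybT.
have sleft : a <<= b -> splithead rep (merge 0 x) = merge_splitl rep x.
  move=> ab; have eab := eq_rep idem (bandeq_mull idem ab).
  by rewrite sE lE eab band_rect.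
have sright : b <<= a -> splithead rep (merge 0 x) = merge_splitr rep x.
  move=> ba; have eab := eq_rep idem (bandeq_mulr idem ba).
  by rewrite sE rE eab mulgA (@band_rect _ idem (rep b) a b) // -?(bandeq_lel idem _ rb) // bandeq_sym.
rewrite wE.
have [ab|nab] := boolP (a <<= b).
  rewrite (wleft ab) (sleft ab).
  have [ba|nba] := boolP (b <<= a); last first.
    have -> : bandmin b x = false.
      by apply: contraNF nba => /bandminP; apply; rewrite // xE mem_head.
    rewrite mul0r subr0 subrK /fixedpair /bandeq /= (negbTE nba) andbF andFb andbT //.
  have eab : a ~~ b by rewrite /bandeq ab ba.
  have aeb : (rep a * a * b = rep a * b)%g.
    by rewrite (@band_rect _ idem) // -?(bandeq_lel idem _ ra) ?bandlexx // bandeq_sym (bandeq_trans idem _ ra) // bandeq_sym.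
  rewrite -(sright ba) (sleft ab) lE mulgA aeb (phi_rectangular xE) //.
  rewrite -(wleft ab) (wright ba); case: (bandmin b x); case: (fixedpair _) => /=; ring.
have nfix : fixedpair (a, b) = false by rewrite /fixedpair /bandeq /= (negbTE nab).
rewrite nfix andbT.
rewrite [X in _ - X - _]( _ : _ = 0) ?subr0; last first.
  by case amin: (bandmin a x); rewrite ?mul0r // (splitl_eq0 xE) ?mulr0.
have [ba|nba] := boolP (b <<= a).
  by rewrite (wright ba) (sright ba) subrK.
rewrite [X in _ - X]( _ : _ = 0) ?subr0; last first.
  by case bmin: (bandmin b x); rewrite ?mul0r // (splitr_eq0 xE) ?mulr0.
rewrite [X in _ + X]( _ : _ = 0) ?addr0 //.
by case abmin: (bandmin (a * b)%g _); rewrite ?mul0r // mE (splithead_merge_eq0 xE) ?mulr0.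
Qed.
End Step.
End BandHomotopy.

(** * Exactness on bounded cochains *)

Section Bounded.
Local Open Scope ring_scope.
Variables (K : numFieldType) (T : Type).
Implicit Types (f g : seq T -> K).

Definition bounded_on n f := exists M : K, forall x, size x = n -> `|f x| <= M.

Lemma bounded_onD n f g : bounded_on n f -> bounded_on n g ->
  bounded_on n (fun x => f x + g x).
Proof.
move=> [M Mf] [N Ng]; exists (M + N) => x sx.
by rewrite (le_trans (ler_normD _ _)) // lerD ?Mf ?Ng.
Qed.

Lemma bounded_onZ n c f : bounded_on n f -> bounded_on n (fun x => c * f x).
Proof.
by move=> [M Mf]; exists (`|c| * M) => x sx; rewrite normrM ler_wpM2l ?Mf.
Qed.

Lemma bounded_on_cycsum n f : bounded_on n f -> bounded_on n (cycsum f).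
Proof.
move=> [M Mf]; exists (M *+ n) => x sx; rewrite /cycsum sx.
rewrite (le_trans (ler_norm_sum _ _ _)) // -[in leRHS](card_ord n) -sumr_const.
apply: ler_sum => i _; rewrite normrM normrX normrN1 expr1n mul1r.
by rewrite Mf ?size_rot.
Qed.

End Bounded.

Section Exactness.
Local Open Scope ring_scope.
Variables (K : numFieldType) (S : semigroupType).
Hypothesis idem : forall x : S, (x * x = x)%g.
Implicit Types (a b z : S) (x y : seq S) (phi psi : seq S -> K).
Local Notation contr := (contract rep (@minhead K S)).

Lemma cycfunD m phi psi : cycfun m phi -> cycfun m psi ->
  cycfun m (fun x => phi x + psi x).
Proof. by move=> cphi cpsi x sx; rewrite cphi // cpsi // mulrDr. Qed.

Lemma cycfunZ m c phi : cycfun m phi -> cycfun m (fun x => c * phi x).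
Proof. by move=> cphi x sx; rewrite cphi // mulrCA. Qed.

Lemma bounded_contract m phi : bounded_on m.+2 phi -> bounded_on m.+1 (contr phi).
Proof.
move=> [M Mphi]; apply: bounded_on_cycsum; exists M => -[|a x] //= [sx].
have h : `|phi [:: a * rep a, rep a * a & x]%g| <= M by rewrite Mphi //= sx.
rewrite normrM; case: (_ && _); rewrite /= ?normr1 ?mul1r // normr0 mul0r.
exact: le_trans h.
Qed.

Lemma bounded_cobnd m phi : bounded_on m.+1 phi -> bounded_on m.+2 (cobnd phi).
Proof.
move=> [M Mphi]; apply: bounded_on_cycsum; exists M => y sy.
by rewrite Mphi // size_merge0 sy.
Qed.

Definition defect x : nat := \sum_(k < size x) unsettled (rot k x).

Lemma defect_leq x : (defect x <= size x)%N.
Proof.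
rewrite -[X in (_ <= X)%N]card_ord -sum1_card; apply: leq_sum => k _.
exact: leq_b1.
Qed.

(** Let [a] be a minimal entry and e its representative. If a letter b of the class of [a] is
    settled, the next letter c is in the class too, with b = b e and c = e c. Once around the cycle
    every letter satisfies both equations, and c = e c e = e. *)
Lemma defect_eq0 m x : size x = m.+2 -> defect x = 0%N ->
  exists a, x = nseq m.+2 (rep a).
Proof.
move=> sx /eqP; rewrite sum_nat_eq0 => /forallP /= d0.
have settled k : (k <= m.+2)%N -> unsettled (rot k x) = false.
  move=> kx; have {kx} : (k < m.+2)%N || (k == m.+2) by rewrite orbC -leq_eqVlt.
  case/orP => [|/eqP ->]; rewrite -{1}sx.
    by move=> kx; have := d0 (Ordinal kx); rewrite eqb0 => /negbTE.
  have z0 : (0 < size x)%N by rewrite sx.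
  by have := d0 (Ordinal z0); rewrite eqb0 [nat_of_ord _]/= rot0 rot_size => /negbTE.
have [a ax amin] : exists2 a, a \in x & bandmin a x by apply: ex_bandmin; rewrite // -size_eq0 sx.
exists a; have [i y0 iE] := rot_to ax.
(* [rot_to] does not bound the rotation; beyond the length it is trivial and 0 serves as well. *)
wlog ix : i iE / (i <= m.+2)%N.
  move=> wl; have [im|mi] := leqP i m.+2; first exact: wl im.
  by apply: (wl 0%N) => //; rewrite rot0 -iE rot_oversize // sx ltnW.
set x' := rot i x in iE; have sx' : size x' = m.+2 by rewrite size_rot.
have {}settled k : (k <= m.+2)%N -> unsettled (rot k x') = false.
  by move=> km; rewrite rot_add_mod ?sx //; case: ifP => h; apply: settled => //; lia.
have xx' : x' =i x by move=> z; rewrite mem_rot.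
have step k b y : (k < m.+2)%N -> rot k x' = b :: y -> bandeq a b ->
    exists c y', [/\ rot k.+1 x' = c :: y', bandeq a c, b = (b * rep a)%g & c = (rep a * c)%g].
  move=> km kE ab; have := settled k (ltnW km); have := size_rot k x'; rewrite kE sx'.
  case: y kE => // c y kE _.
  rewrite /unsettled; have -> : bandmin b [:: b, c & y].
    rewrite -kE (@bandmin_mem _ _ _ x) => [|z]; last by rewrite mem_rot.
    by rewrite -(bandmin_eqv idem _ ab).
  move=> /negbFE /and3P[/= bc /eqP bE /eqP cE].
  exists c, (rcons y b); split.
  - by rewrite -add1n rotD ?sx' // kE rot1_cons.
  - exact: bandeq_trans ab bc.
  - by rewrite (eq_rep idem ab).
  - by rewrite (eq_rep idem (bandeq_trans idem ab bc)).
have chain k : (k <= m.+2)%N -> exists c y,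
    [/\ rot k x' = c :: y, bandeq a c & (0 < k)%N -> c = (rep a * c)%g].
  elim: k => [|k IH] km; first by exists a, y0; rewrite rot0 iE bandeqxx.
  have [b [y [kE ab _]]] := IH (ltnW km).
  have [c [y' [kE' ac _ cE]]] := step k b y km kE ab.
  by exists c, y'.
have settle c : bandeq a c -> c = (c * rep a)%g -> c = (rep a * c)%g -> c = rep a.
  move=> ac cE1 cE2; rewrite cE2 [X in (_ * X)%g]cE1 mulgA band_rectL //.
  by apply: bandeq_trans ac; rewrite // bandeq_sym bandeq_rep.
rewrite -[RHS]/(nseq m.+2 (rep a)) -sx; apply/all_pred1P/allP => z; rewrite -xx' => zx.
rewrite /= ; apply/eqP; set k := index z x'.
have km : (k < m.+2)%N by rewrite -sx' index_mem.
have [c [y [kE ac cE]]] := chain k (ltnW km).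
have zc : z = c by move: kE; rewrite /k rot_index // => -[].
have [_ [_ [_ _ cE' _]]] := step k c y km kE ac.
rewrite zc; apply: settle => //.
(* The first letter has no predecessor in the chain; its left equation comes from the last step of a
   full turn. *)
have [k0|] := posnP k; last exact: cE.
have [d [y' [kE2 _ dE]]] := chain m.+2 (leqnn _).
have dc : d = c.
  by move: kE2; rewrite -sx' rot_size => x'E; move: kE; rewrite k0 rot0 x'E => -[].
by rewrite -dc; apply: dE.
Qed.

Lemma contract_step (I : finType) (g : I -> S) m phi x :
  cycfun m.+2 phi -> (forall y, size y = m.+3 -> cobnd phi y = 0) ->
  size x = m.+2 -> (forall z, z \in x -> meetlike g z) ->
  (forall y, size y = m.+2 -> (forall z, z \in y -> meetlike g z) ->
     (potential g x < potential g y)%N -> phi y = 0) ->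
  cobnd (contr phi) x = (defect x)%:R * phi x.
Proof.
move=> cphi dphi sx mx phi0.
rewrite (cobnd_contract _ (mulrepK idem) cphi dphi sx).
rewrite /defect natr_sum sx -(cycsum_cycfun (fun y => (unsettled y)%:R) cphi sx).
apply: eq_bigr => k _; congr (_ * _).
apply: (minhead_homotopy idem (g := g)) => //; first by rewrite size_rot.
  by move=> z; rewrite mem_rot; apply: mx.
by move=> y sy my; rewrite potential_rot; apply: phi0.
Qed.

Lemma merge_nseq j n a : (a * a = a)%g -> (j <= n)%N ->
  merge j (nseq n.+2 a) = nseq n.+1 a.
Proof.
by move=> aa; elim: j n => [|j IH] [|n] //= jn; rewrite ?aa //; congr (_ :: _); apply: IH.
Qed.

(** Corrections must preserve the vanishing at constant words. At such a word every term is again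
    the value there, with weight 1, and the signs + - - + cancel. *)
Lemma contract_nseq m phi a :
  cycfun m.+2 phi -> (forall y, size y = m.+3 -> cobnd phi y = 0) ->
  cobnd (contr phi) (nseq m.+2 (rep a)) = 0.
Proof.
move=> cphi dphi; rewrite (cobnd_contract _ (mulrepK idem) cphi dphi) ?size_nseq //.
rewrite /cycsum big1 // => k _.
set e := rep a; have ee : (e * e = e)%g := idem e.
have re : rep e = e := rep_rep idem a.
have rotE j : rot j (nseq m.+2 e) = nseq m.+2 e.
  have [jm|mj] := leqP j m.+2; last by rewrite rot_oversize // size_nseq ltnW.
  by rewrite /rot drop_nseq take_nseq // -nseqD subnK.
have minE n : minhead K (nseq n.+1 e) = 1.
  rewrite -[LHS]/((bandmin e (nseq n.+1 e))%:R); have -> // : bandmin e (nseq n.+1 e).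
  by apply/bandminP => b; rewrite mem_nseq => /andP[_ /eqP->].
have splitE : splithead rep (nseq m.+1 e) = nseq m.+2 e by rewrite /= re !ee.
rewrite !rotE merge_nseq // splitE !minE.
rewrite [X in _ + X]big1 => [|j _]; last first.
  by rewrite merge_nseq // minE subrr mulr0 mul0r.
have -> : merge_splitl rep (nseq m.+2 e) = nseq m.+2 e by rewrite /= re !ee.
have -> : merge_splitr rep (nseq m.+2 e) = nseq m.+2 e by rewrite /= re !ee.
by rewrite subrr sub0r addNr addr0 mulr0.
Qed.

Definition normalized m phi :=
  [/\ cycfun m.+2 phi, forall y, size y = m.+3 -> cobnd phi y = 0,
      bounded_on m.+2 phi & forall a, phi (nseq m.+2 (rep a)) = 0].

(** The family [g] is quantified inside, so one corrected cochain serves all families at once;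
    [m.+2] generators suffice for the letters of one word. *)
Definition vanishes_from m B phi := forall (g : 'I_m.+2 -> S) x, size x = m.+2 ->
  (forall z, z \in x -> meetlike g z) -> (B <= potential g x)%N -> phi x = 0.

Definition contract_correct c phi x : K := phi x - c * cobnd (contr phi) x.

Lemma cobndD phi psi x : cobnd (fun y => phi y + psi y) x = cobnd phi x + cobnd psi x.
Proof. exact: cycsumD. Qed.

Lemma cobndZ c phi x : cobnd (fun y => c * phi y) x = c * cobnd phi x.
Proof. exact: cycsumZ. Qed.

Lemma normalized_correct m c phi : normalized m phi -> normalized m (contract_correct c phi).
Proof.
move=> [cphi dphi bphi phi0]; have cycc := @cycfun_cycsum K S.
have ch : cycfun m.+1 (contr phi) by apply: cycfun_cycsum.
have cdh : cycfun m.+2 (cobnd (contr phi)) by apply: cycfun_cycsum.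
rewrite /contract_correct; split.
- move=> x sx; rewrite cphi // cdh //; ring.
- move=> y sy; rewrite -[LHS]/(cycsum (fun x => phi (merge 0 x) - c * cobnd (contr phi) (merge 0 x)) y).
  rewrite (@eq_cycsum _ _ _ (fun x => phi (merge 0 x) + - c * cobnd (contr phi) (merge 0 x))).
    rewrite cycsumD cycsumZ -/(cobnd phi y) dphi // -/(cobnd (cobnd (contr phi)) y).
    rewrite (cobnd_cobnd _ ch) ?mulr0 ?addr0 //.
    by apply: GRing.mulfI; rewrite pnatr_eq0.
  by move=> x _; rewrite mulNr.
- move: (bounded_cobnd (bounded_contract bphi)) => /(bounded_onZ (- c)) /(bounded_onD bphi) [M h].
  by exists M => x sx; rewrite -mulNr h.
- by move=> a; rewrite phi0 contract_nseq // mulr0 subr0.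
Qed.

Lemma correct_vanishes m B c phi : normalized m phi -> vanishes_from m B.+1 phi ->
  forall (g : 'I_m.+2 -> S) x, size x = m.+2 ->
  (forall z, z \in x -> meetlike g z) -> (B <= potential g x)%N ->
  contract_correct c phi x = (1 - c * (defect x)%:R) * phi x.
Proof.
move=> [cphi dphi _ _] vphi g x sx mx Bx.
rewrite /contract_correct (contract_step cphi dphi sx mx) ?mulrBl ?mul1r ?mulrA //.
by move=> y sy my xy; apply: (vphi g) => //; apply: leq_ltn_trans Bx xy.
Qed.

(* The correction with factor [1 / k] multiplies the values at potential [B] by
   [1 - defect / k], so [k = 1, ..., m.+2] kill all those with nonzero defect. *)
Lemma vanishes_reduce m B phi : normalized m phi -> vanishes_from m B.+1 phi ->
  exists phi' psi, [/\ normalized m phi', vanishes_from m B phi',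
    cycfun m.+1 psi, bounded_on m.+1 psi &
    forall x, size x = m.+2 -> phi x = phi' x + cobnd psi x].
Proof.
move=> nphi vphi.
suff: forall k, exists phi' psi, [/\ normalized m phi', vanishes_from m B.+1 phi',
    (forall (g : 'I_m.+2 -> S) x, size x = m.+2 ->
       (forall z, z \in x -> meetlike g z) -> (B <= potential g x)%N ->
       (0 < defect x <= k)%N -> phi' x = 0),
    cycfun m.+1 psi /\ bounded_on m.+1 psi &
    forall x, size x = m.+2 -> phi x = phi' x + cobnd psi x].
  move=> /(_ m.+2) [phi' [psi [nphi' vphi' dphi' [cpsi bpsi] E]]].
  exists phi', psi; split => // g x sx mx Bx.
  have [d0|d0] := posnP (defect x); last first.
    by apply: (dphi' g) => //; rewrite d0 -sx defect_leq.
  by have [a ->] := defect_eq0 sx d0; case: nphi'.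
elim=> [|k [phi' [psi [nphi' vphi' dphi' [cpsi bpsi] E]]]].
  exists phi, (fun=> 0); split=> //.
  - by move=> g x _ _ _ /andP[d0]; rewrite leqn0 => /eqP d1; rewrite d1 in d0.
  - by split=> [x _|]; [rewrite mulr0 | exists 0 => x _; rewrite normr0].
  - by move=> x sx; rewrite /cyccobnd cycsum0 addr0.
have [cphi' dphi'' bphi' _] := nphi'.
pose c : K := k.+1%:R^-1.
exists (contract_correct c phi'), (fun x => psi x + c * contr phi' x); split.
- exact: normalized_correct.
- move=> g x sx mx Bx; rewrite (correct_vanishes c nphi' vphi' sx mx (ltnW Bx)).
  by rewrite (vphi' g) ?mulr0.
- move=> g x sx mx Bx /andP[d0]; rewrite leq_eqVlt ltnS => /orP[/eqP dx|dk].
    rewrite (correct_vanishes c nphi' vphi' sx mx Bx) dx.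
    by rewrite mulVf ?pnatr_eq0 // subrr mul0r.
  by rewrite (correct_vanishes c nphi' vphi' sx mx Bx) (dphi' g) ?mulr0 // d0.
- split; first by apply: cycfunD => //; apply: cycfunZ; apply: cycfun_cycsum.
  by apply: bounded_onD => //; apply: bounded_onZ; apply: bounded_contract.
- move=> x sx; rewrite E // cobndD cobndZ /contract_correct; ring.
Qed.

Theorem band_cyclic_exact m phi : normalized m phi ->
  exists psi, [/\ cycfun m.+1 psi, bounded_on m.+1 psi &
    forall x, size x = m.+2 -> phi x = cobnd psi x].
Proof.
suff H B : forall phi, normalized m phi -> vanishes_from m B phi ->
  exists psi, [/\ cycfun m.+1 psi, bounded_on m.+1 psi &
    forall x, size x = m.+2 -> phi x = cobnd psi x].
  (* This is [potential_bound] for [m.+2] generators and words of length [m.+2]; from it on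
     [vanishes_from] is vacuous. *)
  move=> nphi; apply: (H ((2 ^ m.+2).+1 * m.+3 ^ 2)%N _ nphi) => g x sx mx.
  rewrite leqNgt; by have := potential_bound g x; rewrite card_ord sx => ->.
elim: B => [|B IH] {}phi nphi vphi.
  exists (fun=> 0); split.
  - by move=> x _; rewrite mulr0.
  - by exists 0 => x _; rewrite normr0.
  - move=> x sx; rewrite /cyccobnd cycsum0.
    (* The bound 0 excludes no word, and every word is admissible over the family of its own
       letters, so [phi] vanishes on words of this length. *)
    case: x sx => // a x sx; pose g (i : 'I_m.+2) := nth a (a :: x) i.
    apply: (vphi g) => // z zx.
    have zm : (index z (a :: x) < m.+2)%N by rewrite -sx index_mem.
    have <- : g (Ordinal zm) = z by rewrite /g /= nth_index.
    exact: meetlike_gen.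
have [phi' [psi [nphi' vphi' cpsi bpsi E]]] := vanishes_reduce nphi vphi.
have [psi' [cpsi' bpsi' E']] := IH _ nphi' vphi'.
exists (fun x => psi' x + psi x); split.
- exact: cycfunD.
- exact: bounded_onD.
- by move=> x sx; rewrite E // E' // cobndD.
Qed.
End Exactness.

(** * Sums over a set *)

Section Sums.
Local Open Scope ring_scope.
Variables (R : realType) (T : choiceType) (D : set T).
Implicit Types (a b p q : T -> R) (f g : T -> R[i]).

Definition rsummable a := (\esum_(t in D) `|a t|%:E < +oo)%E.

Lemma rsummable_le a b : (forall t, `|a t| <= `|b t|) -> rsummable b -> rsummable a.
Proof.
move=> ab; apply: le_lt_trans; apply: le_esum => t _; by rewrite lee_fin.
Qed.

Lemma esum_nneg_fin p : (forall t, 0 <= p t) -> rsummable p ->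
  (fine (\esum_(t in D) (p t)%:E))%:E = (\esum_(t in D) (p t)%:E)%E.
Proof.
move=> p0 sp; rewrite fineK // ge0_fin_numE; last first.
  by apply: esum_ge0 => t _; rewrite lee_fin.
by apply: le_lt_trans sp; apply: le_esum => t _; rewrite lee_fin ger0_norm.
Qed.

Lemma rsummableD a b : rsummable a -> rsummable b -> rsummable (fun t => a t + b t).
Proof.
move=> sa sb; apply: (@le_lt_trans _ _ (\esum_(t in D) (`|a t|%:E + `|b t|%:E)%E)).
  by apply: le_esum => t _; rewrite -EFinD lee_fin ler_normD.
by rewrite esumD ?lte_add_pinfty // => t _; rewrite lee_fin.
Qed.

Lemma rsummableZ c a : rsummable a -> rsummable (fun t => c * a t).
Proof.
move=> sa; rewrite /rsummable.
rewrite (_ : (\esum_(t in D) _)%E = (`|c|%:E * \esum_(t in D) `|a t|%:E)%E).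
  by rewrite lte_mul_pinfty ?lee_fin.
rewrite -esumZ //.
by apply: eq_esum => t _; rewrite -EFinM normrM.
Qed.

(** Positive parts are not additive. Additivity and scaling of [rsum] rest on the fact that every
    decomposition into nonnegative summable families gives the same difference, as [ap + q = an + p]
    termwise. *)
Lemma rsum_diff a p q : (forall t, 0 <= p t) -> (forall t, 0 <= q t) ->
  rsummable p -> rsummable q -> (forall t, a t = p t - q t) ->
  rsum D a = fine (\esum_(t in D) (p t)%:E) - fine (\esum_(t in D) (q t)%:E).
Proof.
move=> p0 q0 sp sq apq.
pose ap t := Num.max (a t) 0; pose an t := Num.max (- a t) 0.
have ap0 t : 0 <= ap t by rewrite /ap le_max lexx orbT.
have an0 t : 0 <= an t by rewrite /an le_max lexx orbT.
have pq t : ap t + q t = an t + p t.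
  rewrite /ap /an /Num.max !apq; case: ltP => h1; case: ltP => h2; lra.
have sap : rsummable ap.
  apply: rsummable_le sp => t; rewrite !ger0_norm // /ap apq ge_max p0 andbT.
  by rewrite gerBl.
have san : rsummable an.
  apply: rsummable_le sq => t; rewrite !ger0_norm // /an apq ge_max q0 andbT.
  by rewrite opprB gerBl.
have E : fine (\esum_(t in D) (ap t)%:E) + fine (\esum_(t in D) (q t)%:E) =
         fine (\esum_(t in D) (an t)%:E) + fine (\esum_(t in D) (p t)%:E).
  apply: EFin_inj; rewrite !EFinD !esum_nneg_fin // -!esumD;
    try by move=> t _; rewrite lee_fin.
  by apply: eq_esum => t _; rewrite -!EFinD pq.
rewrite /rsum -/ap -/an; lra.
Qed.

Lemma maxr0_ge0 (r : R) : 0 <= Num.max r 0.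
Proof. by rewrite le_max lexx orbT. Qed.

Lemma max_posneg (r : R) : Num.max r 0 - Num.max (- r) 0 = r.
Proof.
have [r0|r0] := leP 0 r; rewrite ?(max_l r0) ?(max_r (ltW r0)).
  by rewrite max_r ?subr0 // oppr_le0.
by rewrite max_l ?sub0r ?opprK // oppr_ge0 ltW.
Qed.

Lemma rsummable_pos a : rsummable a -> rsummable (fun t => Num.max (a t) 0).
Proof.
apply: rsummable_le => t; rewrite ger0_norm ?maxr0_ge0 // ge_max normr_ge0 andbT.
exact: ler_norm.
Qed.

Lemma rsummableN a : rsummable a -> rsummable (fun t => - a t).
Proof. by apply: rsummable_le => t; rewrite normrN. Qed.

Lemma rsumD a b : rsummable a -> rsummable b ->
  rsum D (fun t => a t + b t) = rsum D a + rsum D b.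
Proof.
move=> sa sb; have [sna snb] := (rsummableN sa, rsummableN sb).
have [pa pb] := (rsummable_pos sa, rsummable_pos sb).
have [na nb] := (rsummable_pos sna, rsummable_pos snb).
rewrite (@rsum_diff _ (fun t => Num.max (a t) 0 + Num.max (b t) 0)
  (fun t => Num.max (- a t) 0 + Num.max (- b t) 0)); first last.
- by move=> t; rewrite opprD addrACA !max_posneg.
- exact: rsummableD.
- exact: rsummableD.
- by move=> t; rewrite addr_ge0 ?maxr0_ge0.
- by move=> t; rewrite addr_ge0 ?maxr0_ge0.
have E p q : (forall t, 0 <= p t) -> (forall t, 0 <= q t) -> rsummable p -> rsummable q ->
  fine (\esum_(t in D) (p t + q t)%:E) =
  fine (\esum_(t in D) (p t)%:E) + fine (\esum_(t in D) (q t)%:E).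
  move=> p0 q0 sp sq; apply: EFin_inj.
  rewrite EFinD !esum_nneg_fin //; [|by move=> t; rewrite addr_ge0|exact: rsummableD].
  rewrite -esumD; try by move=> t _; rewrite lee_fin.
  by apply: eq_esum => t _.
rewrite (E (fun t => Num.max (a t) 0) (fun t => Num.max (b t) 0)) //;
  [|by move=> t; rewrite maxr0_ge0|by move=> t; rewrite maxr0_ge0].
rewrite (E (fun t => Num.max (- a t) 0) (fun t => Num.max (- b t) 0)) //;
  [|by move=> t; rewrite maxr0_ge0|by move=> t; rewrite maxr0_ge0].
rewrite /rsum; ring.
Qed.

Lemma rsumN a : rsum D (fun t => - a t) = - rsum D a.
Proof.
rewrite /rsum opprB; congr (_ - fine _); apply: eq_esum => t _.
by rewrite opprK.
Qed.

Lemma rsumZ c a : rsummable a -> rsum D (fun t => c * a t) = c * rsum D a.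
Proof.
move=> sa; wlog c0 : c / 0 <= c => [wl|].
  have [|c0] := leP 0 c; first exact: wl.
  rewrite -[RHS]opprK -mulNr -wl ?oppr_ge0 ?(ltW c0) // -rsumN.
  by congr rsum; apply/funext => t; rewrite mulNr opprK.
have E p : (forall t, 0 <= p t) -> rsummable p ->
    fine (\esum_(t in D) (c * p t)%:E) = c * fine (\esum_(t in D) (p t)%:E).
  move=> p0 sp; apply: EFin_inj; rewrite EFinM !esum_nneg_fin //.
  - rewrite -esumZ //; by apply: eq_esum => t _.
  - by move=> t; rewrite mulr_ge0.
  - exact: rsummableZ.
rewrite (@rsum_diff _ (fun t => c * Num.max (a t) 0) (fun t => c * Num.max (- a t) 0)).
- rewrite (E (fun t => Num.max (a t) 0)); first last.
  + exact: rsummable_pos.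
  + by move=> t; rewrite maxr0_ge0.
  rewrite (E (fun t => Num.max (- a t) 0)); first last.
  + exact/rsummable_pos/rsummableN.
  + by move=> t; rewrite maxr0_ge0.
  by rewrite mulrBr.
- by move=> t; rewrite mulr_ge0 ?maxr0_ge0.
- by move=> t; rewrite mulr_ge0 ?maxr0_ge0.
- exact/rsummableZ/rsummable_pos.
- exact/rsummableZ/rsummable_pos/rsummableN.
- by move=> t; rewrite -mulrBr max_posneg.
Qed.

Lemma esum_single (a : T -> \bar R) x : (0 <= a x)%E -> (forall t, t != x -> a t = 0%E) ->
  (\esum_(t in D) a t = if x \in D then a x else 0)%E.
Proof.
move=> ax0 a0; have nn t : D t -> (0 <= a t)%E.
  by move=> _; have [->|/a0 ->] := eqVneq t x.
rewrite (esumID [set x]) //.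
rewrite [X in (_ + X)%E]esum1 ?adde0; last by move=> t [_ /eqP]; exact: a0.
case: ifPn => xD; last first.
  rewrite esum1 // => t [Dt tx]; move: Dt; rewrite tx => Dx.
  by move: xD; rewrite notin_setE.
rewrite (_ : D `&` [set x] = [set x]) ?esum_set1 //.
by apply/seteqP; split => [t [] //|t ->]; split=> //; rewrite inE in xD.
Qed.

Lemma rsum_single a x : (forall t, t != x -> a t = 0) ->
  rsum D a = if x \in D then a x else 0.
Proof.
move=> a0; rewrite /rsum (@esum_single _ x) ?lee_fin ?maxr0_ge0 //; last first.
  by move=> t /a0 ->; rewrite maxxx.
rewrite (@esum_single _ x) ?lee_fin ?maxr0_ge0 //; last first.
  by move=> t /a0 ->; rewrite oppr0 maxxx.
case: ifP => _; last by rewrite subrr.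
by rewrite /= max_posneg.
Qed.

End Sums.

Section ComplexSums.
Local Open Scope ring_scope.
Local Open Scope complex_scope.
Variables (R : realType) (T : choiceType) (D : set T).
Implicit Types (f g : T -> R[i]).

Definition csummable f := (\esum_(t in D) (normc (f t))%:E < +oo)%E.

Lemma normc_ReIm (z : R[i]) : `|complex.Re z| <= normc z /\ `|complex.Im z| <= normc z.
Proof.
case: z => x y; split; rewrite /normc /= -sqrtr_sqr ler_sqrt ?lerDl ?lerDr ?sqr_ge0 //;
  by rewrite addr_ge0 ?sqr_ge0.
Qed.

Lemma csummable_le f g : (forall t, D t -> normc (f t) <= normc (g t)) ->
  csummable g -> csummable f.
Proof.
move=> fg; apply: le_lt_trans; apply: le_esum => t Dt; by rewrite lee_fin fg.
Qed.

Lemma esum_normcZ c f :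
  (\esum_(t in D) (normc (c * f t))%:E = (normc c)%:E * \esum_(t in D) (normc (f t))%:E)%E.
Proof.
rewrite -esumZ ?Defs.normc_ge0 // => [|t]; last by rewrite lee_fin Defs.normc_ge0.
by apply: eq_esum => t _; rewrite -EFinM normcM.
Qed.

Lemma csummableZ c f : csummable f -> csummable (fun t => c * f t).
Proof.
move=> sf; rewrite /csummable esum_normcZ.
by rewrite lte_mul_pinfty ?lee_fin ?Defs.normc_ge0.
Qed.

Lemma csummable_Re f : csummable f -> rsummable D (fun t => complex.Re (f t)).
Proof.
apply: le_lt_trans; apply: le_esum => t _; rewrite lee_fin.
by have [] := normc_ReIm (f t).
Qed.

Lemma csummable_Im f : csummable f -> rsummable D (fun t => complex.Im (f t)).
Proof.
apply: le_lt_trans; apply: le_esum => t _; rewrite lee_fin.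
by have [] := normc_ReIm (f t).
Qed.

Lemma csumD f g : csummable f -> csummable g ->
  csum D (fun t => f t + g t) = csum D f + csum D g.
Proof.
move=> sf sg; have [rf rg] := (csummable_Re sf, csummable_Re sg).
have [jf jg] := (csummable_Im sf, csummable_Im sg).
by rewrite /csum; simpc; rewrite -!rsumD //; congr (rsum D _ +i* rsum D _);
  apply/funext => t; case: (f t) (g t) => ? ? [].
Qed.

Lemma csumZ c f : csummable f -> csum D (fun t => c * f t) = c * csum D f.
Proof.
move=> sf; have [rf jf] := (csummable_Re sf, csummable_Im sf).
case: c => x y.
have E u v : rsum D (fun t => u * complex.Re (f t) + v * complex.Im (f t)) =
    u * rsum D (fun t => complex.Re (f t)) + v * rsum D (fun t => complex.Im (f t)).
  by rewrite rsumD ?rsumZ //; exact: rsummableZ.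
rewrite /csum; simpc.
congr (_ +i* _); last rewrite addrC.
  rewrite -mulNr; apply: etrans (E _ _).
  by congr (rsum D _); apply/funext => t; case: (f t) => u v /=; rewrite mulNr.
apply: etrans (E _ _).
by congr (rsum D _); apply/funext => t; case: (f t) => u v /=; rewrite addrC.
Qed.

Lemma csum_single f x : (forall t, t != x -> f t = 0) ->
  csum D f = if x \in D then f x else 0.
Proof.
move=> f0; rewrite /csum !(@rsum_single _ _ _ _ x); try by move=> t /f0 ->.
by case: ifP => // _; case: (f x).
Qed.

End ComplexSums.

(** * Functionals and convolution on ell1 *)

Section Ell1.
Local Open Scope ring_scope.
Local Open Scope complex_scope.
Variables (R : realType) (I : choiceType).
Implicit Types (f g : ell1 R I) (h : I -> R[i]).

Lemma ell1_normE f : `|f| = (fine (ell1_esum f))%:C.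
Proof. by []. Qed.

Lemma ell1_csummable f : csummable setT (fun i => f i).
Proof. exact: ell1_valP. Qed.

Lemma ell1D f g i : (f + g) i = f i + g i.
Proof. by []. Qed.

Lemma ell1Z (c : R[i]) f i : (c *: f) i = c * f i.
Proof. by []. Qed.

Lemma basis_subproof i :
  (fun j : I => (j == i)%:R : R[i]^o) \in @ell1_pred R I.
Proof.
rewrite unfold_in /ell1_esum (@esum_single _ _ _ _ i); last 2 first.
- by rewrite lee_fin Defs.normc_ge0.
- by move=> t /negbTE ->; rewrite normc0.
by rewrite in_setT ltry.
Qed.

Definition basis i : ell1 R I := Ell1 (basis_subproof i).

Lemma basisE i j : basis i j = (j == i)%:R.
Proof. by []. Qed.

Lemma normr_basis i : `|basis i| = 1.
Proof.
rewrite ell1_normE /ell1_esum (@esum_single _ _ _ _ i); last 2 first.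
- by rewrite lee_fin Defs.normc_ge0.
- by move=> t ti; rewrite basisE (negbTE ti) normc0.
by rewrite in_setT basisE eqxx; congr _%:C; exact: normc1.
Qed.

(** The pairing of bounded functions with summable ones; for unbounded [h] the family need not be
    summable and the value has no meaning. *)
Definition dual_of_bounded h f : R[i] := csum setT (fun i => h i * f i).

Lemma normc_le_bound (M : R[i]) (z : R[i]) : `|z| <= M -> normc z <= normc M.
Proof.
by move=> zM; rewrite -lecR -!normc_norm [leRHS]ger0_norm // (le_trans (normr_ge0 z) zM).
Qed.

Lemma csummable_dual h M f : (forall i, `|h i| <= M) ->
  csummable setT (fun i => h i * f i).
Proof.
move=> hM; apply: (@csummable_le _ _ _ _ (fun i => M * f i)).
  move=> i _; rewrite !normcM ler_wpM2r ?Defs.normc_ge0 //; exact: normc_le_bound.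
exact/csummableZ/ell1_csummable.
Qed.

Lemma dual_of_bounded_linear h M (c : R[i]) f g : (forall i, `|h i| <= M) ->
  dual_of_bounded h (c *: f + g) = c * dual_of_bounded h f + dual_of_bounded h g.
Proof.
move=> hM; have sf := csummable_dual f hM; have sg := csummable_dual g hM.
rewrite /dual_of_bounded -csumZ // -csumD //; last exact: csummableZ.
by congr csum; apply/funext => i; rewrite ell1D ell1Z mulrDr mulrCA.
Qed.

Lemma dual_of_bounded_linearl h1 h2 M1 M2 (c : R[i]) f : (forall i, `|h1 i| <= M1) ->
  (forall i, `|h2 i| <= M2) ->
  dual_of_bounded (fun i => c * h1 i + h2 i) f = c * dual_of_bounded h1 f + dual_of_bounded h2 f.
Proof.
move=> h1M h2M; have sf := csummable_dual f h1M; have sg := csummable_dual f h2M.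
rewrite /dual_of_bounded -csumZ // -csumD //; last exact: csummableZ.
by congr csum; apply/funext => i; rewrite mulrDl mulrA.
Qed.

Lemma dual_of_bounded_basis h i : dual_of_bounded h (basis i) = h i.
Proof.
rewrite /dual_of_bounded (@csum_single _ _ _ _ i) => [|j ji]; last by rewrite basisE (negbTE ji) mulr0.
by rewrite in_setT basisE eqxx mulr1.
Qed.

(** The factor 2 is inherited from [csum_le], where real and imaginary parts are bounded
    separately. *)
Lemma dual_of_bounded_bound h M f : (forall i, `|h i| <= M) ->
  `|dual_of_bounded h f| <= 2%:R * `|M| * `|f|.
Proof.
move=> hM; rewrite !normc_norm ell1_normE -[2%:R](rmorph_nat (real_complex R)) -!rmorphM lecR.
rewrite -lee_fin (le_trans (csum_le _ _)) // !EFinM -muleA.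
rewrite lee_wpmul2l // ell1_esumK -esum_normcZ.
apply: le_esum => i _; rewrite lee_fin !normcM ler_wpM2r ?Defs.normc_ge0 //.
exact: normc_le_bound.
Qed.

Lemma ell1_drop_subproof f (s : seq I) :
  (fun i => if i \in s then 0 else f i : R[i]^o) \in @ell1_pred R I.
Proof.
apply: le_lt_trans (ell1_valP f); apply: le_esum => i _; rewrite lee_fin.
by case: ifP => // _; rewrite normc0 Defs.normc_ge0.
Qed.

Definition ell1_drop f s : ell1 R I := Ell1 (ell1_drop_subproof f s).

Lemma ell1_drop_cons f i s : i \notin s ->
  ell1_drop f s = f i *: basis i + ell1_drop f (i :: s).
Proof.
move=> is'; apply/val_inj/funext => j.
rewrite -[RHS]/(f i * (j == i)%:R + (if j \in i :: s then 0 else f j)).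
rewrite /= inE; case: (eqVneq j i) => [->|ji]; first by rewrite (negbTE is') mulr1 addr0.
by rewrite mulr0 add0r.
Qed.

Lemma ell1_esum_drop f s : uniq s ->
  ell1_esum f = ((\sum_(i <- s) normc (f i))%:E + ell1_esum (ell1_drop f s))%E.
Proof.
elim: s => [|i s IH] /= => [_|/andP[is' us]].
  by rewrite big_nil add0e; apply: eq_esum.
rewrite IH // big_cons EFinD [X in _ = (X + _)%E]addeC -addeA; congr (_ + _)%E.
pose d j : \bar R := (normc (if j == i then f i : R[i] else 0))%:E.
pose r (s' : seq I) j : \bar R := (normc (if j \in s' then 0 : R[i] else f j))%:E.
have nn (z : R[i]) : (0 <= (normc z)%:E)%E by rewrite lee_fin Defs.normc_ge0.
have -> : (normc (f i))%:E = (\esum_(j in [set: I]) d j)%E.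
  rewrite (@esum_single _ _ _ _ i) /d ?eqxx ?in_setT //.
  by move=> j /negbTE ->; rewrite normc0.
rewrite -[LHS]/(\esum_(j in [set: I]) r s j)%E.
rewrite -[X in (_ = _ + X)%E]/(\esum_(j in [set: I]) r (i :: s) j)%E.
rewrite -esumD; [|by move=> j _; exact: nn|by move=> j _; exact: nn].
apply: eq_esum => j _; rewrite /r /d inE.
have [->|ji] := eqVneq j i; last by rewrite normc0 add0e.
by rewrite (negbTE is') normc0 adde0.
Qed.

(** Density of the basis without limits: deleting finitely many coordinates does not change [F f],
    so [normc (F f)] plus [normc M] times any finite partial sum of [f] is at most [normc M] times
    the full sum. The supremum over finite sets leaves no room for [F f]. *)
Lemma ell1_dual_ext (F : ell1 R I -> R[i]) (M : R[i]) :
  (forall c f g, F (c *: f + g) = c * F f + F g) ->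
  (forall f, `|F f| <= M * `|f|) -> (forall i, F (basis i) = 0) ->
  forall f, F f = 0.
Proof.
move=> Flin Fbd F0 f; apply: eq0_normc; apply/eqP; rewrite eq_le Defs.normc_ge0 andbT.
have Fbd' g : normc (F g) <= normc M * fine (ell1_esum g).
  have := normc_le_bound (Fbd g); rewrite normcM ell1_normE /= expr0n /= addr0.
  by rewrite sqrtr_sqr ger0_norm // fine_ge0 // ell1_esum_ge0.
have Fdrop s : uniq s -> F f = F (ell1_drop f s).
  elim: s => [_|i s IH /= /andP[is' us]].
    by congr F; apply/val_inj/funext.
  by rewrite IH // (ell1_drop_cons f is') Flin F0 mulr0 add0r.
have key s : uniq s -> normc (F f) + normc M * \sum_(i <- s) normc (f i) <=
    normc M * fine (ell1_esum f).
  move=> us; rewrite (ell1_esum_drop f us) -(ell1_esumK (ell1_drop f s)) /= mulrDr.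
  by rewrite addrC lerD2l (Fdrop s us) Fbd'.
have [M0|M0] := eqVneq (normc M) 0.
  by have := key [::] isT; rewrite M0 !mul0r addr0.
have {}M0 : 0 < normc M by rewrite lt_def M0 Defs.normc_ge0.
pose u := fine (ell1_esum f) - normc (F f) / normc M.
have : (ell1_esum f <= u%:E)%E.
  apply: ge_ereal_sup => _ [A [finA _] <-]; rewrite fsbig_finite //= sumEFin lee_fin.
  rewrite /u lerBrDr -(ler_pM2l M0) mulrDr mulrCA divff ?gt_eqF // mulr1 addrC.
  apply: key; exact: finmap.fset_uniq.
rewrite -ell1_esumK lee_fin /u lerBrDr gerDl.
by rewrite pmulr_lle0 ?invr_gt0.
Qed.

End Ell1.

Arguments basis R {I}.

Section Convolution.
Local Open Scope ring_scope.
Local Open Scope complex_scope.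
Variables (R : realType) (S : semigroupType).
Implicit Types (f g : ell1 R S) (s : S).
Local Notation mul := (@ell1_mul R S).

Lemma esum_ell1_prod f g :
  (\esum_(p in [set: S * S]) (normc (f p.1 * g p.2 : R[i]))%:E =
     ell1_esum f * ell1_esum g)%E.
Proof.
transitivity (\esum_(x in [set: S]) \esum_(y in [set: S]) (normc (f x * g y : R[i]))%:E)%E.
  rewrite esum_esum // => [|x y _ _]; last by rewrite lee_fin Defs.normc_ge0.
  by rewrite (_ : _ `*`` _ = setT) //; apply/seteqP; split.
transitivity (\esum_(x in [set: S]) (ell1_esum g * (normc (f x))%:E))%E.
  by apply: eq_esum => x _; rewrite esum_normcZ muleC.
rewrite -(ell1_esumK g) esumZ ?fine_ge0 ?ell1_esum_ge0 //; last first.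
  by move=> x; rewrite lee_fin Defs.normc_ge0.
by rewrite muleC.
Qed.

Lemma csummable_conv f g (D : set (S * S)) :
  csummable D (fun p => f p.1 * g p.2).
Proof.
apply: (@le_lt_trans _ _ (ell1_esum f * ell1_esum g)%E); last first.
  by rewrite -(ell1_esumK f) -(ell1_esumK g) -EFinM ltry.
rewrite -esum_ell1_prod [leRHS](esumID D); last first.
  by move=> p _; rewrite lee_fin Defs.normc_ge0.
rewrite setTI leeDl // esum_ge0 // => p _; by rewrite lee_fin Defs.normc_ge0.
Qed.

Lemma ell1_mulE f g s :
  mul f g s = csum [set p : S * S | (p.1 * p.2 = s)%g] (fun p => f p.1 * g p.2).
Proof. by []. Qed.

Lemma ell1_mul_linearl (c : R[i]) f f' g : mul (c *: f + f') g = c *: mul f g + mul f' g.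
Proof.
apply/val_inj/funext => s.
rewrite -[RHS]/(c * mul f g s + mul f' g s) !ell1_mulE.
rewrite -csumZ; last exact: csummable_conv.
rewrite -csumD; [|exact/csummableZ/csummable_conv|exact: csummable_conv].
by congr csum; apply/funext => p; rewrite ell1D ell1Z mulrDl mulrA.
Qed.

Lemma ell1_mul_linearr (c : R[i]) f g g' : mul f (c *: g + g') = c *: mul f g + mul f g'.
Proof.
apply/val_inj/funext => s.
rewrite -[RHS]/(c * mul f g s + mul f g' s) !ell1_mulE.
rewrite -csumZ; last exact: csummable_conv.
rewrite -csumD; [|exact/csummableZ/csummable_conv|exact: csummable_conv].
by congr csum; apply/funext => p; rewrite ell1D ell1Z mulrDr mulrCA.
Qed.

Lemma ell1_mul_basis x y : mul (basis R x) (basis R y) = basis R (x * y)%g.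
Proof.
apply/val_inj/funext => s; rewrite -[RHS]/((s == (x * y)%g)%:R) -[LHS]/(mul (basis R x) (basis R y) s) ell1_mulE.
rewrite (@csum_single _ _ _ _ (x, y)) => [|[a b] nab]; last first.
  rewrite !basisE /=; move: nab; rewrite xpair_eqE.
  by case: (a == x) => /= nab; rewrite ?mul0r // (negbTE nab) mulr0.
rewrite !basisE !eqxx mulr1 eq_sym; case: eqVneq => [E|nE].
  by rewrite mem_set.
by rewrite memNset //=; apply/eqP.
Qed.

Lemma normr_ell1_mul f g : `|mul f g| <= 2%:R * (`|f| * `|g|).
Proof.
rewrite !ell1_normE -[2%:R](rmorph_nat (real_complex R)) -!rmorphM lecR.
rewrite -lee_fin !EFinM !ell1_esumK -esum_ell1_prod.
pose F (p : S * S) := (normc (f p.1 * g p.2 : R[i]))%:E.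
have F0 p : (0 <= F p)%E by rewrite lee_fin Defs.normc_ge0.
have -> : (\esum_(p in [set: S * S]) F p =
    \esum_(s in [set: S]) \esum_(p in [set p : S * S | (p.1 * p.2 = s)%g]) F p)%E.
  rewrite esum_esum //.
  rewrite (reindex_esum [set: S * S] _ (fun p => ((p.1 * p.2)%g, p))) //.
  by split=> //= [p q _ _ [_ //]|[s p] /= [_ <-]]; exists p.
rewrite -esumZ //; last by move=> s; exact: esum_ge0.
by apply: le_esum => s _; exact: csum_le.
Qed.

End Convolution.

(** * Multilinear forms on lists *)

Section Multiforms.
Local Open Scope ring_scope.
Variables (K : numFieldType) (A : normedModType K) (mul : A -> A -> A).
Implicit Types (F G : seq A -> K) (u v l : seq A) (x y z : A).

(** On lists the last argument of a cochain is like the others, so rotations and merges act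
    uniformly; a cochain of degree [n] becomes a form in [n.+1] arguments. *)
Definition multiform n F :=
  (forall u v c x y, (size u + size v).+1 = n ->
     F (u ++ (c *: x + y) :: v) = c * F (u ++ x :: v) + F (u ++ y :: v)) /\
  exists M : K, forall l, size l = n -> `|F l| <= M * \prod_(x <- l) `|x|.

Lemma prod_norm_ge0 l : 0 <= \prod_(x <- l) `|x|.
Proof. by apply: prodr_ge0. Qed.

(** The bound in [multiform] is an arbitrary scalar, possibly not even real; [|M|] makes it monotone
    in the other factors. *)
Lemma norm_bound (z M p : K) : `|z| <= M * p -> 0 <= p -> `|z| <= `|M| * p.
Proof.
move=> zM p0; have := le_trans (normr_ge0 z) zM => Mp0.
by rewrite (le_trans zM) // -[in leLHS](ger0_norm Mp0) normrM (ger0_norm p0).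
Qed.

Lemma eq_multiform n F G : (forall l, size l = n -> F l = G l) ->
  multiform n F -> multiform n G.
Proof.
move=> FG [linF [M bF]]; split=> [u v c x y suv|].
  by rewrite -!FG ?linF // size_cat /= addnS.
by exists M => l sl; rewrite -FG ?bF.
Qed.

Lemma multiformZD n c F G : multiform n F -> multiform n G ->
  multiform n (fun l => c * F l + G l).
Proof.
move=> [linF [M bF]] [linG [N bG]]; split=> [u v d x y suv|].
  rewrite linF // linG //; ring.
exists (`|c| * M + N) => l sl; rewrite (le_trans (ler_normD _ _)) // mulrDl.
by rewrite lerD ?bG // normrM -mulrA ler_wpM2l ?bF.
Qed.

Lemma multiform0 n : multiform n (fun=> 0).
Proof.
split=> [*|]; first by rewrite mulr0 addr0.
by exists 0 => l _; rewrite mul0r normr0.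
Qed.

Lemma multiformD n F G : multiform n F -> multiform n G ->
  multiform n (fun l => F l + G l).
Proof.
move=> mF mG; apply: eq_multiform (multiformZD 1 mF mG) => l _; by rewrite mul1r.
Qed.

Lemma multiformZ n c F : multiform n F -> multiform n (fun l => c * F l).
Proof.
move=> mF; apply: eq_multiform (multiformZD c mF (multiform0 n)) => l _.
by rewrite addr0.
Qed.

Lemma multiform_sum n k (F : 'I_k -> seq A -> K) : (forall i, multiform n (F i)) ->
  multiform n (fun l => \sum_(i < k) F i l).
Proof.
elim: k F => [|k IH] F mF.
  by apply: eq_multiform (multiform0 n) => l _; rewrite big_ord0.
have := multiformD (mF ord0) (IH _ (fun i => mF (lift ord0 i))).
by apply: eq_multiform => l _; rewrite big_ord_recl.
Qed.

Lemma multiform_rot1 n F : multiform n F -> multiform n (F \o rot 1).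
Proof.
move=> [linF [M bF]]; split=> [[|a u] v c x y suv|].
- by rewrite /= !rot1_cons -!cats1 linF //= addn0 -suv.
- rewrite /= !rot1_cons !rcons_cat !rcons_cons linF //= size_rcons.
  by move: suv => /=; rewrite addSn addnS.
exists M => l sl /=.
by rewrite (le_trans (bF _ _)) ?size_rot // (perm_big l) // perm_rot.
Qed.

Lemma multiform_rot n F k : multiform n F -> (k <= n)%N -> multiform n (F \o rot k).
Proof.
elim: k F => [|k IH] F mF kn; first by apply: eq_multiform mF => l _ /=; rewrite rot0.
have := IH _ (multiform_rot1 mF) (ltnW kn).
by apply: eq_multiform => l sl /=; rewrite -[k.+1]add1n rotD ?sl.
Qed.

Hypothesis mul_linearl : forall c x y z, mul (c *: x + y) z = c *: mul x z + mul y z.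
Hypothesis mul_linearr : forall c x y z, mul z (c *: x + y) = c *: mul z x + mul z y.
Variable C : K.
Hypothesis norm_mul : forall x y, `|mul x y| <= C * (`|x| * `|y|).

Lemma multiform_merge0 n F : multiform n.+1 F -> multiform n.+2 (F \o mergeat mul 0).
Proof.
move=> [linF [M bF]]; split=> [[|a [|b u]] v c x y|].
- case: v => // b v [sv]; rewrite /= mul_linearl.
  by apply: (linF [::]); rewrite /= sv.
- by move=> [sv]; rewrite /= mul_linearr; apply: (linF [::]); rewrite /= -sv.
- by move=> [sv]; apply: (linF (mul a b :: u)); rewrite /= -sv.
exists (`|M| * C) => -[|a [|b l]] // [sl] /=.
have := bF (mul a b :: l); rewrite /= sl => /(_ erefl) h.
rewrite (le_trans (norm_bound h (prod_norm_ge0 _))) // !big_cons -mulrA ler_wpM2l //.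
by rewrite !mulrA ler_wpM2r ?prod_norm_ge0 // -mulrA norm_mul.
Qed.

Lemma multiform_cyccobnd n F : multiform n.+1 F -> multiform n.+2 (cyccobnd mul F).
Proof.
move=> mF.
have h (k : 'I_n.+2) : multiform n.+2 (fun l =>
    (-1) ^+ (n.+1 * k) * (F (mergeat mul 0 (rot k l)))).
  apply: multiformZ; exact: (multiform_rot (multiform_merge0 mF) (ltnW (ltn_ord k))).
apply: eq_multiform (multiform_sum h) => l sl.
by rewrite /cyccobnd /cycsum sl.
Qed.

(* The value of [T] at a list of length [n.+1]; shorter lists are padded by [0]. *)
Definition form_of n (T : ('I_n -> A) -> A -> K) l : K :=
  pairing T (fun i => nth 0 l i).

Definition of_form n F : ('I_n -> A) -> A -> K :=
  fun a x => F (rcons [seq a i | i <- enum 'I_n] x).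

Lemma nth_enum_map n (a : 'I_n -> A) (i : 'I_n) : nth 0 [seq a j | j <- enum 'I_n] i = a i.
Proof. by rewrite (nth_map i) ?size_enum_ord // nth_ord_enum. Qed.

Lemma form_ofK n (T : ('I_n -> A) -> A -> K) : of_form (form_of T) = T.
Proof.
apply/funext => a; apply/funext => x; rewrite /of_form /form_of /pairing.
rewrite nth_rcons size_map size_enum_ord ltnn eqxx; congr (T _ x).
apply/funext => i; rewrite nth_rcons size_map size_enum_ord /= ltn_ord.
exact: nth_enum_map.
Qed.

Lemma of_formK n F l : size l = n.+1 -> form_of (@of_form n F) l = F l.
Proof.
move=> sl; rewrite /form_of /pairing /of_form; congr F.
apply: (@eq_from_nth _ 0) => [|i]; rewrite size_rcons size_map size_enum_ord //.
move=> im; rewrite nth_rcons size_map size_enum_ord.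
case: ltngtP => [ni|ni|-> //]; last by lia.
by rewrite (nth_enum_map (fun i : 'I_n => nth 0 l (widen_ord (leqnSn n) i)) (Ordinal ni)).
Qed.

Lemma eq_of_form n F G : (forall l, size l = n.+1 -> F l = G l) ->
  @of_form n F = of_form G.
Proof.
move=> FG; apply/funext => a; apply/funext => x; rewrite /of_form FG //.
by rewrite size_rcons size_map size_enum_ord.
Qed.

Lemma form_of_inj n (T U : ('I_n -> A) -> A -> K) :
  (forall l, size l = n.+1 -> form_of T l = form_of U l) -> T = U.
Proof. by move=> TU; rewrite -(form_ofK T) -(form_ofK U); apply: eq_of_form. Qed.

Lemma set_coord_map n (a : 'I_n -> A) (i : 'I_n) x :
  [seq set_coord a i x j | j <- enum 'I_n] =
  take i [seq a j | j <- enum 'I_n] ++ x :: drop i.+1 [seq a j | j <- enum 'I_n].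
Proof.
have sa : size [seq a j | j <- enum 'I_n] = n by rewrite size_map size_enum_ord.
apply: (@eq_from_nth _ 0).
  rewrite size_cat /= size_drop size_take !sa size_map size_enum_ord ltn_ord.
  have := ltn_ord i; lia.
rewrite size_map size_enum_ord => j jn.
rewrite -[j]/(nat_of_ord (Ordinal jn)) nth_enum_map nth_cat size_take sa ltn_ord.
rewrite /set_coord; case: ltngtP => [ji|ij|ij].
- rewrite nth_take // nth_enum_map; case: eqP => // E; move: ji; by rewrite E ltnn.
- have -> : ((Ordinal jn : nat) - i = (j - i.+1).+1)%N by move: ij => /=; lia.
  rewrite /= nth_drop subnKC // -[j]/(nat_of_ord (Ordinal jn)) nth_enum_map.
  by case: eqP => // E; move: ij; rewrite E ltnn.
- by rewrite -ij subnn /=; case: eqP => // E; case: E; apply: val_inj.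
Qed.

Lemma cochain_of_form n F : multiform n.+1 F -> cochain (@of_form n F).
Proof.
move=> [linF [M bF]].
have sa (a : 'I_n -> A) : size [seq a j | j <- enum 'I_n] = n by rewrite size_map size_enum_ord.
have bF' (a : 'I_n -> A) x : `|of_form F a x| <= M * \prod_(i < n) `|a i| * `|x|.
  rewrite /of_form (le_trans (bF _ _)) ?size_rcons ?sa //.
  by rewrite -cats1 big_cat big_seq1 big_map /= big_enum mulrA.
split.
- move=> a; split; last by exists (M * \prod_(i < n) `|a i|) => x; exact: bF'.
  by move=> c x y; rewrite /of_form -!cats1 linF // sa addn0.
- move=> a i c x y z; rewrite /of_form !set_coord_map !rcons_cat !rcons_cons linF //.
  rewrite size_rcons size_drop size_take sa ltn_ord; have := ltn_ord i; lia.
- by exists M.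
Qed.

Lemma form_of_cochain n (T : ('I_n -> A) -> A -> K) : cochain T -> multiform n.+1 (form_of T).
Proof.
move=> [dT linT [M bT]]; split=> [u v c x y [suv]|].
  rewrite /form_of /pairing.
  (* Linearity has two sources: in the last argument it is that of the functional [T a], in the
     others that of the tuple. *)
  case: (lastP v) suv => [|v' z] suv.
    rewrite !nth_cat addn0 in suv *; rewrite /= suv ltnn subnn /=.
    have E w : (fun i : 'I_n => nth 0 (u ++ [:: w]) (widen_ord (leqnSn n) i)) =
               (fun i : 'I_n => nth 0 u i).
      by apply/funext => i; rewrite nth_cat suv /= ltn_ord.
    by rewrite !E; have [lin _] := dT (fun i : 'I_n => nth 0 u i); rewrite lin.
  rewrite size_rcons in suv.
  have un : (size u < n)%N by lia.
  have En w : nth 0 (u ++ w :: rcons v' z) (@ord_max n) = z.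
    rewrite nth_cat ltnNge (ltnW un) /=; have -> : (n - size u = (size v').+1)%N by lia.
    by rewrite /= nth_rcons ltnn eqxx.
  rewrite !En.
  have [a E] : exists a, forall w,
      (fun i : 'I_n => nth 0 (u ++ w :: rcons v' z) (widen_ord (leqnSn n) i)) =
      set_coord a (Ordinal un) w.
    exists (fun i => nth 0 (u ++ x :: rcons v' z) i) => w; apply/funext => i; rewrite /set_coord /= !nth_cat.
    case: eqP => [->|ni] /=; first by rewrite ltnn subnn.
    case: ltngtP => // [ui|ui]; last by case: ni; apply: val_inj.
    by have -> : (i - size u = (i - (size u).+1).+1)%N by lia.
  by rewrite !E linT.
exists M => l sl; rewrite /form_of /pairing (le_trans (bT _ _)) // -mulrA.
by rewrite (big_nth 0) sl big_mkord big_ord_recr.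
Qed.

Lemma cochainE n (T : ('I_n -> A) -> A -> K) : cochain T <-> multiform n.+1 (form_of T).
Proof.
split; first exact: form_of_cochain.
by move=> mT; rewrite -(form_ofK T); apply: cochain_of_form.
Qed.
End Multiforms.

(** * Cyclicity and the coboundary on lists *)

Section CyclicForms.
Local Open Scope ring_scope.
Variables (K : numFieldType) (A : normedModType K) (mul : A -> A -> A).
Implicit Types (F G : seq A -> K) (u v l : seq A) (x y z : A).

Lemma nth_rot1_pred n l : size l = n.+1 ->
  (fun i : 'I_n.+1 => nth 0 (rot 1 l) (ord_pred i)) = (fun i : 'I_n.+1 => nth 0 l i).
Proof.
case: l => // a t [st]; apply/funext => -[i im]; rewrite rot1_cons /= nth_rcons st.
case: i im => [|i] im /=; first by rewrite modn_small // ltnn eqxx.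
have -> : ((i.+1 + n.+1).-1 %% n.+1 = i)%N.
  by rewrite addSn /= modnDr modn_small // ltnW.
by rewrite -ltnS im.
Qed.

Lemma pairing_form_of n (T : ('I_n -> A) -> A -> K) (b : 'I_n.+1 -> A) :
  pairing T b = form_of T [seq b i | i <- enum 'I_n.+1].
Proof.
rewrite /form_of; congr pairing; apply/funext => i.
by rewrite nth_enum_map.
Qed.

(** [ord_pred] rotates backwards and [cycfun] forwards; evaluation at [rot 1 l] turns one condition
    into the other. *)
Lemma cyclicE n (T : ('I_n -> A) -> A -> K) : cyclic T <-> cycfun n.+1 (form_of T).
Proof.
split=> [cT l sl|cT b].
  by have := cT (fun i => nth 0 (rot 1 l) i); rewrite nth_rot1_pred.
set lb := [seq b i | i <- enum 'I_n.+1].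
have slb : size lb = n.+1 by rewrite size_map size_enum_ord.
have sl : size (rotr 1 lb) = n.+1 by rewrite size_rotr.
rewrite [RHS]pairing_form_of -/lb -[in RHS](rotrK 1 lb) cT //; congr (_ * _).
rewrite /form_of -nth_rot1_pred // rotrK; congr pairing; apply/funext => i.
by rewrite nth_enum_map.
Qed.

Lemma rcons_coord_widen n (b : 'I_n.+1 -> A) :
  rcons_coord (fun i => b (widen_ord (leqnSn n) i)) (b ord_max) = b.
Proof.
apply/funext => i; rewrite /rcons_coord; case: unliftP => [j ->|->] //.
by congr b; apply: val_inj; rewrite /= /bump leqNgt ltn_ord.
Qed.

Lemma nth_mergeat j l i : (j.+1 < size l)%N ->
  nth 0 (mergeat mul j l) i = if (i < j)%N then nth 0 l i
    else if i == j then mul (nth 0 l i) (nth 0 l i.+1) else nth 0 l i.+1.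
Proof.
elim: j l i => [|j IH] [|a l] i //=.
  by case: l => // b l _; case: i.
by rewrite ltnS => jl; case: i => [|i] //=; rewrite IH // ltnS eqSS.
Qed.

Lemma pairing_face n (T : ('I_n -> A) -> A -> K) l (j : 'I_n.+1) : size l = n.+2 ->
  pairing T (face mul j (fun i : 'I_n.+2 => nth 0 l i)) = form_of T (mergeat mul j l).
Proof.
move=> sl; congr pairing; apply/funext => i; rewrite nth_mergeat ?sl ?ltnS //.
by rewrite -ltnS.
Qed.

Lemma pairing_face0 n (T : ('I_n -> A) -> A -> K) l : size l = n.+2 ->
  pairing T (face0 mul (fun i : 'I_n.+2 => nth 0 l i)) =
  form_of T (rot 1 (mergeat mul 0 (rot n.+1 l))).
Proof.
case: (lastP l) => // -[|x r] c; rewrite size_rcons // => -[sr].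
have -> : rot n.+1 (rcons (x :: r) c) = [:: c, x & r].
  by rewrite -cats1 -sr; exact: (rot_size_cat (x :: r)).
rewrite -[mergeat _ _ _]/(mul c x :: r) rot1_cons.
congr pairing; apply/funext => i; rewrite /face0.
have [->|ni] := eqVneq i ord_max.
  by rewrite /= !nth_rcons sr ltnn eqxx.
have im : (i < n)%N.
  by rewrite ltn_neqAle -ltnS ltn_ord andbT; apply: contraNneq ni => ?; apply/eqP/val_inj.
by rewrite lift0 /= !nth_rcons sr im.
Qed.

(** Merging at [j] is merging at the head after [rot j], up to a rotation of the result. Cyclicity
    turns the sign [(-1) ^+ (n.+1 * j)] of [cyccobnd] into [(-1) ^+ j], opposite to that of
    [face j]; the rotation by [n.+1] accounts for [face0]. *)
Lemma form_of_coboundary n (T : ('I_n -> A) -> A -> K) l : size l = n.+2 ->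
  cycfun n.+1 (form_of T) ->
  form_of (coboundary mul T) l = - cyccobnd mul (form_of T) l.
Proof.
move=> sl cT; rewrite {1}/form_of /pairing /coboundary.
rewrite (rcons_coord_widen (fun i : 'I_n.+2 => nth 0 l i)) pairing_face0 //.
rewrite cT ?size_merge0 ?size_rot ?sl //.
have -> : cyccobnd mul (form_of T) l =
    \sum_(k < n.+1) (-1) ^+ (n.+1 * k) * form_of T (mergeat mul 0 (rot k l)) +
    (-1) ^+ (n.+1 * n.+1) * form_of T (mergeat mul 0 (rot n.+1 l)).
  by rewrite /cyccobnd /cycsum sl big_ord_recr.
rewrite opprD addrC; congr (_ + _).
  rewrite -sumrN; apply: eq_bigr => j _; rewrite pairing_face //.
  have [u [a [b [v [lE su]]]]] : exists u a b v, l = u ++ [:: a, b & v] /\ size u = j.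
    by apply: split_pair; rewrite sl ltnS ltn_ord.
  have sm : size (mergeat mul j l) = n.+1.
    by move: sl; rewrite lE -su mergeat_cat !size_cat /=; lia.
  have -> : mergeat mul 0 (rot j l) = rot j (mergeat mul j l).
    by rewrite lE -su mergeat_cat !rot_size_cat.
  rewrite (cycfun_rot cT sm (ltnW (ltn_ord j))) mulrA -exprD -mulNr; congr (_ * _).
  by rewrite -[RHS]mulN1r -exprS; apply: eq_sign_odd; parity.
rewrite /= -mulNr; congr (_ * _); rewrite -[RHS]mulN1r -exprS.
by apply: eq_sign_odd; parity.
Qed.

End CyclicForms.

(** * From functions on words to cochains *)

Section Extension.
Local Open Scope ring_scope.
Local Open Scope complex_scope.
Variables (R : realType) (S : semigroupType).
Local Notation A := (ell1 R S).
Local Notation mul := (@ell1_mul R S).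
Implicit Types (F G : seq A -> R[i]) (l u v : seq A) (t : seq S)
  (phi psi : seq S -> R[i]).

(** Arguments become basis vectors one at a time from the right: with all others fixed, [F] is a
    bounded functional of a single argument. *)
Lemma multiform_ext n F : multiform n F ->
  (forall t, size t = n -> F (map (basis R) t) = 0) ->
  forall l, size l = n -> F l = 0.
Proof.
move=> [linF [M bF]] F0 l sl.
suff H : forall u t, (size u + size t)%N = n -> F (u ++ map (basis R) t) = 0.
  by rewrite -[l]cats0; apply: (H l [::]); rewrite addn0.
elim/last_ind => [|u x IH] t; first exact: F0.
rewrite size_rcons -cats1 -catA /= => sut.
pose N := `|M| * \prod_(y <- u ++ map (basis R) t) `|y|.
apply: (@ell1_dual_ext _ _ (fun x => F (u ++ x :: map (basis R) t)) N).
- by move=> c f g; rewrite linF // size_map -addSn.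
- move=> f; have sz : size (u ++ f :: map (basis R) t) = n.
    by rewrite size_cat /= size_map addnS -addSn.
  rewrite (le_trans (norm_bound (bF _ sz) (prod_norm_ge0 _))) // /N.
  by rewrite !big_cat big_cons /= -!mulrA (mulrC `|f|).
- by move=> i; apply: (IH (i :: t)); rewrite /= addnS -addSn.
Qed.

(** Iterated sums, one variable at a time; each costs the factor 2 of [dual_of_bounded_bound], hence
    the power of 2 in [extend_bound]. *)
Fixpoint extend phi l : R[i] :=
  if l is a :: l' then dual_of_bounded (fun s => extend (fun t => phi (s :: t)) l') a
  else phi [::].

Lemma extend_bound phi l M : (forall t, size t = size l -> `|phi t| <= M) ->
  `|extend phi l| <= 2 ^+ size l * `|M| * \prod_(x <- l) `|x|.
Proof.
elim: l phi => [|a l IH] phi bphi /=.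
  rewrite big_nil expr0 mul1r mulr1; have h := bphi [::] erefl.
  by rewrite [leRHS]ger0_norm // (le_trans (normr_ge0 _) h).
set N := 2 ^+ size l * `|M| * \prod_(x <- l) `|x|.
have N0 : 0 <= N by rewrite !mulr_ge0 ?prod_norm_ge0 ?exprn_ge0 ?ler0n.
rewrite (le_trans (dual_of_bounded_bound (M := N) _ _)) //.
  by move=> s; apply: IH => t st; apply: bphi; rewrite /= st.
rewrite ger0_norm // /N big_cons exprS le_eqVlt; apply/orP; left; apply/eqP; ring.
Qed.

Lemma extend_linear phi u v c x y M :
  (forall t, size t = (size u + size v).+1 -> `|phi t| <= M) ->
  extend phi (u ++ (c *: x + y) :: v) =
    c * extend phi (u ++ x :: v) + extend phi (u ++ y :: v).
Proof.
elim: u phi => [|a u IH] phi bphi /=.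
  apply: dual_of_bounded_linear => s; apply: (extend_bound (M := M)) => t st.
  by apply: bphi; rewrite /= st.
have sz w : size (u ++ w :: v) = (size u + size v).+1 by rewrite size_cat addnS.
rewrite -(dual_of_bounded_linearl (M1 := 2 ^+ size (u ++ x :: v) * `|M| * \prod_(z <- u ++ x :: v) `|z|)
  (M2 := 2 ^+ size (u ++ y :: v) * `|M| * \prod_(z <- u ++ y :: v) `|z|)).
- apply: (congr1 (fun h => dual_of_bounded h a)); apply/funext => s; apply: IH => t st; apply: bphi.
  by rewrite /= st addSn.
- by move=> s; apply: extend_bound => t st; apply: bphi; rewrite /= st sz addSn.
- by move=> s; apply: extend_bound => t st; apply: bphi; rewrite /= st sz addSn.
Qed.

Lemma extend_basis phi t : extend phi (map (basis R) t) = phi t.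
Proof. by elim: t phi => //= s t IH phi; rewrite dual_of_bounded_basis IH. Qed.

Lemma multiform_extend n phi : bounded_on n phi -> multiform n (extend phi).
Proof.
move=> [M bphi]; split=> [u v c x y suv|].
  by apply: (@extend_linear phi u v c x y M) => t; rewrite suv; apply: bphi.
exists (2 ^+ n * `|M|) => l sl; rewrite -sl; apply: extend_bound => t.
by rewrite sl; apply: bphi.
Qed.

Lemma multiform_cyccobnd_ell1 n F : multiform n.+1 F ->
  multiform n.+2 (cyccobnd mul F).
Proof.
apply: multiform_cyccobnd; first exact: ell1_mul_linearl.
  by move=> c x y z; exact: ell1_mul_linearr.
exact: normr_ell1_mul.
Qed.

Lemma map_mergeat t j :
  map (basis R) (mergeat *%g j t) = mergeat mul j (map (basis R) t).
Proof.
elim: j t => [|j IH] [|a t] //=; last by rewrite IH.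
by case: t => // b t /=; rewrite ell1_mul_basis.
Qed.

Lemma cyccobnd_basis F t :
  cyccobnd mul F (map (basis R) t) = cyccobnd *%g (F \o map (basis R)) t.
Proof.
rewrite /cyccobnd /cycsum size_map; apply: eq_bigr => k _.
by rewrite -map_rot -map_mergeat.
Qed.

Lemma cycfun_basis n F : multiform n F ->
  cycfun n (F \o map (basis R)) -> cycfun n F.
Proof.
move=> mF cF l sl.
have := @multiform_ext n (fun l => - (-1) ^+ n.-1 * F l + (F \o rot 1) l).
move=> /(_ (multiformZD _ mF (multiform_rot1 mF))) /(_ _ l sl) h.
apply/eqP; rewrite -subr_eq0 addrC -mulNr; apply/eqP/h => t st.
by have := cF t st; rewrite /= map_rot mulNr addrC => ->; rewrite subrr.
Qed.

Section Classes.
Variable n : nat.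
Implicit Types T U V : ('I_n -> A) -> A -> R[i].

Lemma CCE T : CC n T <-> multiform n.+1 (form_of T) /\ cycfun n.+1 (form_of T).
Proof.
by split=> -[h k]; split; [exact/cochainE|exact/cyclicE|exact/cochainE|exact/cyclicE].
Qed.

Lemma ZCE T : ZC mul n T <-> [/\ multiform n.+1 (form_of T), cycfun n.+1 (form_of T) &
  forall l, size l = n.+2 -> cyccobnd mul (form_of T) l = 0].
Proof.
split=> [[/CCE[mT cT] dT]|[mT cT dT]].
  split=> // l sl; apply/eqP; rewrite -oppr_eq0 -form_of_coboundary // dT; exact/eqP.
split; first exact/CCE.
by apply: form_of_inj => l sl; rewrite form_of_coboundary // dT // oppr0.
Qed.

Lemma CCB T U : CC n T -> CC n U -> CC n (T - U).
Proof.
move=> /CCE[mT cT] /CCE[mU cU]; apply/CCE; split.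
  by apply: eq_multiform (multiformZD (-1) mU mT) => l _; rewrite mulN1r addrC.
by move=> l sl; rewrite -[LHS]/(form_of T (rot 1 l) - form_of U (rot 1 l)) cT // cU // -mulrBr.
Qed.

Lemma coboundaryB T U : CC n T -> CC n U ->
  coboundary mul (T - U) = coboundary mul T - coboundary mul U.
Proof.
move=> cT cU; have [_ c] := (CCE (T - U)).1 (CCB cT cU).
have [[_ ccT] [_ ccU]] := ((CCE T).1 cT, (CCE U).1 cU).
apply: form_of_inj => l sl.
rewrite -[RHS]/(form_of (coboundary mul T) l - form_of (coboundary mul U) l).
rewrite !form_of_coboundary // -opprD; congr (- _).
rewrite /cyccobnd -cycsumN -cycsumD; exact: eq_cycsum.
Qed.

End Classes.
End Extension.

(** * Cyclic cohomology classes over a band *)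

Section BandCohomology.
Local Open Scope ring_scope.
Local Open Scope complex_scope.
Variables (R : realType) (S : semigroupType).
Local Notation A := (ell1 R S).
Local Notation mul := (@ell1_mul R S).
Local Notation eb := (basis R).
Implicit Types (F G : seq A -> R[i]) (l : seq A) (t : seq S) (tau : A -> R[i]).

Lemma BCB n T U : BC mul n T -> BC mul n U -> BC mul n (T - U).
Proof.
case: n T U => [|n] T U /=; first by move=> -> ->; rewrite subr0.
move=> [V cV <-] [W cW <-]; exists (V - W); first exact: CCB.
exact: coboundaryB.
Qed.

Lemma form_of0 n l : form_of (0 : ('I_n -> A) -> A -> R[i]) l = 0.
Proof. by []. Qed.

Lemma CC0 n : CC n (0 : ('I_n -> A) -> A -> R[i]).
Proof.
apply/CCE; split=> [|l _]; last by rewrite !form_of0 mulr0.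
by apply: (@eq_multiform _ _ _ (fun=> 0)) => //; apply: multiform0.
Qed.

Lemma coboundary0 n : coboundary mul (0 : ('I_n -> A) -> A -> R[i]) = 0.
Proof. by have := coboundaryB (CC0 n) (CC0 n); rewrite !subrr. Qed.

Lemma BC0 n : BC mul n 0.
Proof.
by case: n => [|n] //=; exists 0; [exact: CC0 | exact: coboundary0].
Qed.

Lemma BCN n T : BC mul n T -> BC mul n (- T).
Proof. by move=> bT; rewrite -sub0r; apply: BCB => //; apply: BC0. Qed.

Lemma ZCB n (T U : ('I_n -> A) -> A -> R[i]) :
  ZC mul n T -> ZC mul n U -> ZC mul n (T - U).
Proof.
move=> [cT dT] [cU dU]; split; first exact: CCB.
by rewrite coboundaryB // dT dU subrr.
Qed.

Lemma eq_cyclic_class n (T U : ('I_n -> A) -> A -> R[i]) :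
  BC mul n (T - U) -> cyclic_class mul T = cyclic_class mul U.
Proof.
move=> bTU; apply/seteqP; split=> _ [V bV <-].
  exists (V + (T - U)); last by rewrite addrCA [U + _]addrC subrK addrC.
  by rewrite -[T - U]opprK; apply: BCB => //; apply: BCN.
exists (V - (T - U)); last by rewrite opprB addrCA [T + _]addrC subrK addrC.
exact: BCB.
Qed.

Lemma cyclic_class0 n : cyclic_class mul (0 : ('I_n -> A) -> A -> R[i]) = BC mul n.
Proof.
apply/seteqP; split=> [_ [V bV <-]|V bV]; first by rewrite add0r.
by exists V => //; rewrite add0r.
Qed.

Hypothesis hS : band S.

Lemma ZC_normalized_BC n T : ZC mul n.+1 T ->
  (forall a : S, form_of T (nseq n.+2 (eb (rep a))) = 0) -> BC mul n.+1 T.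
Proof.
move=> /ZCE[mT cT dT] T0.
have nT : normalized n (form_of T \o map eb).
  split.
  - by move=> t st; rewrite /= map_rot cT // size_map.
  - by move=> t st; rewrite -cyccobnd_basis dT // size_map.
  - have [_ [M bT]] := mT; exists M => t st /=.
    rewrite (le_trans (bT _ _)) ?size_map // big_map big1 ?mulr1 // => s _.
    exact: normr_basis.
  - by move=> a; rewrite /= map_nseq T0.
have [psi [cpsi bpsi E]] := band_cyclic_exact hS nT.
(* The factor -1 makes up for the sign in [form_of_coboundary]. *)
have bpsi' : bounded_on n.+1 (fun t => -1 * psi t) by exact: bounded_onZ.
pose G := extend (fun t => -1 * psi t).
have mG : multiform n.+1 G by exact: multiform_extend.
have cG : cycfun n.+1 G.
  apply: cycfun_basis => // t st; rewrite /= /G !extend_basis cpsi //.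
  by rewrite mulrCA.
have GV l : size l = n.+1 -> form_of (@of_form _ A n G) l = G l by exact: of_formK.
have cV : cycfun n.+1 (form_of (@of_form _ A n G)).
  by move=> l sl; rewrite !GV ?size_rot // cG.
exists (of_form G).
  by apply/CCE; split=> //; apply: eq_multiform mG => l sl; rewrite GV.
apply: form_of_inj => l sl; rewrite form_of_coboundary //.
have -> : cyccobnd mul (form_of (@of_form _ A n G)) l = cyccobnd mul G l.
  by apply: eq_cycsum => y; rewrite sl => sy; rewrite GV // size_merge0 sy.
have := multiformZD 1 mT (multiform_cyccobnd_ell1 mG) => mD.
have D0 := multiform_ext mD _ sl.
apply/eqP; rewrite eq_sym -subr_eq0 opprK -[X in X + _]mul1r; apply/eqP/D0 => t st.
rewrite mul1r cyccobnd_basis -[form_of T _]/((form_of T \o map eb) t) E //.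
rewrite /cyccobnd -cycsumD -(cycsum0 _ t); apply: eq_cycsum => y _.
rewrite -[X in _ + X]/(G (map eb (mergeat *%g 0 y))) /G extend_basis.
by rewrite mulN1r subrr.
Qed.

Lemma ZC_odd_BC n T : ZC mul n.*2.+1 T -> BC mul n.*2.+1 T.
Proof.
move=> zT; apply: ZC_normalized_BC => // a.
have [_ cT _] := (ZCE T).1 zT.
have := cT _ (size_nseq n.*2.+2 (eb (rep a))).
rewrite (_ : rot 1 _ = nseq n.*2.+2 (eb (rep a))); last first.
  by rewrite /rot drop_nseq take_nseq // -nseqD subnK.
rewrite -signr_odd /= odd_double /= expr1 mulN1r => h.
move/eqP: h; rewrite -subr_eq0 opprK -mulr2n mulrn_eq0 /= => /eqP; exact.
Qed.

(* [psi^(n)] on lists. *)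
Definition power_form tau l := tau (foldl mul (head 0 l) (behead l)).

Lemma form_of_power n tau l : size l = n.+1 ->
  form_of (power_cochain mul n tau) l = power_form tau l.
Proof.
case: l => // f l [sl]; rewrite /form_of /pairing /power_cochain.
rewrite (rcons_coord_widen (fun i : 'I_n.+1 => nth 0 (f :: l) i)).
rewrite /tuple_prod /power_form /=; congr (tau (foldl _ _ _)).
apply: (@eq_from_nth _ 0); rewrite size_map size_enum_ord ?sl // => i im.
rewrite (nth_map (Ordinal im)) ?size_enum_ord //.
by rewrite -[X in nth _ (enum _) X]/(nat_of_ord (Ordinal im)) nth_ord_enum.
Qed.

Lemma power_form_merge0 tau l : (1 < size l)%N ->
  power_form tau (mergeat mul 0 l) = power_form tau l.
Proof. by case: l => [|f [|g l]]. Qed.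

Lemma multiform_power n tau : dual_space tau -> multiform n.+1 (power_form tau).
Proof.
move=> [lin [M btau]]; elim: n => [|n IH].
  split=> [u v c x y [/eqP]|].
    by rewrite addn_eq0 => /andP[/nilP-> /nilP->]; rewrite /power_form /= lin.
  by exists M => -[|f [|]] // _; rewrite big_seq1 btau.
have := multiform_merge0 (@ell1_mul_linearl R S)
  (fun c x y z => ell1_mul_linearr c z x y) (@normr_ell1_mul R S) IH.
by apply: eq_multiform => l sl; rewrite /= power_form_merge0 // sl.
Qed.

Lemma foldl_basis a t : foldl mul (eb a) (map eb t) = eb (foldl *%g a t).
Proof. by elim: t a => //= b t IH a; rewrite ell1_mul_basis IH. Qed.

Lemma power_form_basis tau a t :
  power_form tau (map eb (a :: t)) = tau (eb (foldl *%g a t)).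
Proof. by rewrite /power_form /= foldl_basis. Qed.

Lemma foldl_mulg a b t : foldl *%g (a * b)%g t = (a * foldl *%g b t)%g.
Proof. by elim: t b => //= c t IH b; rewrite -mulgA IH. Qed.

Lemma power_form_rot1 tau t : traces mul tau ->
  power_form tau (map eb (rot 1 t)) = power_form tau (map eb t).
Proof.
move=> [_ tr]; case: t => [|a [|b t]] //; rewrite rot1_cons !power_form_basis.
rewrite -/(rcons t a) foldl_rcons /= foldl_mulg.
by rewrite -!ell1_mul_basis tr.
Qed.

Lemma power_form_rot tau t k : traces mul tau -> (k <= size t)%N ->
  power_form tau (map eb (rot k t)) = power_form tau (map eb t).
Proof.
move=> tr; elim: k => [|k IH] kt; first by rewrite rot0.
by rewrite -add1n rotD // power_form_rot1 // IH // ltnW.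
Qed.

Lemma sum_sign n : \sum_(k < n.*2) (-1) ^+ k = 0 :> R[i].
Proof.
elim: n => [|n IH]; first by rewrite big_ord0.
rewrite doubleS !big_ord_recr /= IH add0r exprS mulN1r subrr //.
Qed.

(** On basis words all faces take the same value by the trace property, and the [2n + 2] of them
    carry alternating signs. *)
Lemma ZC_power n tau : traces mul tau -> ZC mul n.*2 (power_cochain mul n.*2 tau).
Proof.
move=> tr; have [dtau _] := tr; have mP k := multiform_power k dtau.
have cP : cycfun n.*2.+1 (power_form tau).
  apply: cycfun_basis => // t st; rewrite /comp power_form_rot1 //.
  by rewrite -signr_odd /= odd_double mul1r.
apply/ZCE; split.
- by apply: eq_multiform (mP n.*2) => l sl; rewrite form_of_power.
- by move=> l sl; rewrite !form_of_power ?size_rot // cP.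
move=> l sl.
have -> : cyccobnd mul (form_of (power_cochain mul n.*2 tau)) l =
          cyccobnd mul (power_form tau) l.
  by apply: eq_cycsum => y; rewrite sl => sy; rewrite form_of_power // size_merge0 sy.
apply: (multiform_ext (multiform_cyccobnd_ell1 (mP n.*2))) sl => t st.
rewrite cyccobnd_basis /cyccobnd /cycsum st.
rewrite (eq_bigr (fun k : 'I__ => (-1) ^+ k * power_form tau (map eb t))) => [|k _].
  by rewrite -mulr_suml -doubleS sum_sign mul0r.
rewrite /comp map_mergeat power_form_merge0 ?size_map ?size_rot ?st //.
rewrite power_form_rot // ?st ?(ltnW (ltn_ord k)) //; congr (_ * _).
by apply: eq_sign_odd; rewrite oddM /= odd_double.
Qed.

Lemma ZC_even_power n T : ZC mul n.*2 T ->
  exists2 tau, traces mul tau & BC mul n.*2 (T - power_cochain mul n.*2 tau).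
Proof.
case: n T => [|n] T zT; have /ZCE[mT cT dT] := zT.
  (* A cocycle of degree 0 is itself a trace, since its coboundary at [[:: f; g]] compares the two
     products; the difference to be bounded is then 0. *)
  have [lin [M bT]] := mT.
  exists (fun f => form_of T [:: f]).
    split; first split.
    - by move=> c f g; exact: (lin [::] [::]).
    - by exists M => f; have := bT [:: f] erefl; rewrite big_seq1.
    - move=> f g; apply/eqP; rewrite -subr_eq0; apply/eqP.
      have := dT [:: f; g] erefl.
      rewrite /cyccobnd /cycsum !big_ord_recl big_ord0 /= => <-.
      by rewrite /bump /= addr0 muln0 mul1r muln1 expr1 mulN1r.
  rewrite /BC /=; apply/eqP; rewrite subr_eq0; apply/eqP/form_of_inj => l sl.
  by rewrite form_of_power //; case: l sl => [|f []].
set m := n.*2.+1.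
have [_ [M bT]] := mT.
pose h (a : S) := form_of T (nseq m.+2 (eb (rep a))).
have bh a : `|h a| <= M.
  rewrite (le_trans (bT _ _)) ?size_nseq // big_nseq.
  by rewrite iter_mulr_1 normr_basis expr1n mulr1.
pose tau f := dual_of_bounded h f.
have dtau : dual_space tau.
  split; first by move=> c f g; apply: (dual_of_bounded_linear (M := M)).
  by exists (2%:R * `|M|) => f; apply: dual_of_bounded_bound.
have tr : traces mul tau.
  split=> [|f g]; first exact: dtau.
  have mP := multiform_power 1 dtau.
  (* The commutator form of [tau] is bilinear and bounded, so it is enough to test it on basis
     vectors. *)
  have : -1 * power_form tau [:: f; g] + (power_form tau \o rot 1) [:: f; g] = 0.
    apply: (multiform_ext (multiformZD (-1) mP (multiform_rot1 mP)) _ (erefl : size [:: f; g] = 2%N)).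
    move=> [|a [|b []]] // _; rewrite /comp -map_rot !power_form_basis.
    rewrite /= /tau !dual_of_bounded_basis /h.
    by rewrite (eq_rep hS (bandeq_mulC hS a b)) mulN1r addNr.
  rewrite /comp rot1_cons mulN1r addrC => /eqP.
  by rewrite subr_eq0 => /eqP E; exact: (esym E).
exists tau => //; apply: (@ZC_normalized_BC m).
  by apply: ZCB => //; apply: (@ZC_power n.+1).
(* The product of copies of [rep a] is [rep a], where [tau] takes the value of [T] at the constant
   word. *)
move=> a; rewrite -[LHS]/(form_of T _ - form_of (power_cochain mul n.+1.*2 tau) _).
rewrite form_of_power ?size_nseq // -map_nseq power_form_basis /tau dual_of_bounded_basis.
have -> : foldl *%g (rep a) (nseq m.+1 (rep a)) = rep a.
  by elim: m.+1 => //= k IH; rewrite hS.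
by rewrite /h rep_rep // map_nseq subrr.
Qed.

End BandCohomology.

Theorem theorem7p2 (R : realType) (S : semigroupType) (hS : band S) (n : nat) :
  HC (@ell1_mul R S) n.*2.+1 = [set BC (@ell1_mul R S) n.*2.+1] /\
  HC (@ell1_mul R S) n.*2 =
    [set cyclic_class (@ell1_mul R S) (power_cochain (@ell1_mul R S) n.*2 tau)
      | tau in traces (@ell1_mul R S)].
Proof.
split; apply/seteqP; split.
- move=> _ [T zT <-]; rewrite -cyclic_class0; apply: eq_cyclic_class.
  by rewrite subr0; apply: ZC_odd_BC.
- move=> _ ->; rewrite -cyclic_class0; exists 0%R => //.
  by split; [exact: CC0 | exact: coboundary0].
- move=> _ [T zT <-]; have [tau tr bc] := ZC_even_power hS zT.
  by exists tau => //; rewrite (eq_cyclic_class bc).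
- by move=> _ [tau tr <-]; exists (power_cochain (@ell1_mul R S) n.*2 tau) => //; apply: ZC_power.
Qed.
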